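(* Consider the system $$\dot w=\Delta_w(w,x),\qquad \dot x=f(x)+g(x)[u+\Delta(w,x)],$$ with the functions $V_i,u_i,\hat u_{i^*+1},\rho,\gamma,e_{ro}$ defined in the context. Assume: (A) There is $\underline\alpha\in\mathcal{K}_\infty$ with $\underline\alpha(|x|)\le V_i(x)$ for all $x\in\mathbb{R}^n$ and $i=0,1,\dots$, and there is a constant $\epsilon>0$ such that $Q(x)-\epsilon^2|x|^2$ is a positive definite function. Let $\bar\alpha\in\mathcal{K}_\infty$ be such that $V_i(x)\le\bar\alpha(|x|)$ for all $x\in\mathbb{R}^n$ and $i=0,1,\dots$. (B) There exist $\underline\lambda,\bar\lambda\in\mathcal{K}_\infty$, $\kappa_1,\kappa_2,\kappa_3\in\mathcal{K}$, and positive definite functions $W$ and $\kappa_4$ such that for all $w\in\mathbb{R}^p$, $x\in\mathbb{R}^n$: $\underline\lambda(|w|)\le W(w)\le\bar\lambda(|w|)$; $|\Delta(w,x)|\le\max\{\kappa_1(|w|),\kappa_2(|x|)\}$; and $W(w)\ge\kappa_3(|x|)$ implies $\nabla W(w)\Delta_w(w,x)\le-\kappa_4(w)$. Suppose $$\gamma>\max\{\kappa_2,\ \kappa_1\circ\underline\lambda^{-1}\circ\kappa_3\circ\underline\alpha^{-1}\circ\bar\alpha\},$$ and that for some constant $d>0$, $$0<V_{i^*}(x)\le d\ \Longrightarrow\ |e_{ro}(x)|<\gamma(|x|).$$ Then the closed-loop system obtained with the control policy $$u=u_{ro}(x)=\Big[1+\frac r2\rho^2(|x|^2)\Big]\hat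 u_{i^*+1}(x)$$ is asymptotically stable at the origin. In addition, there exists $\sigma\in\mathcal{K}_\infty$ such that $$\Omega_{i^*}=\{(w,x):\ \max[\sigma(V_{i^*}(x)),W(w)]\le\sigma(d)\}$$ is an estimate of the region of attraction of the closed-loop system (i.e. it is contained in the region of attraction of the origin).
   Context: Notation. $|\cdot|$ is the Euclidean norm. $\mathcal{K}$: continuous strictly increasing functions $\mathbb{R}_+\to\mathbb{R}_+$ vanishing at $0$; $\mathcal{K}_\infty$: those that are also unbounded. $\gamma_1>\gamma_2$ for functions means $\gamma_1(s)>\gamma_2(s)$ for all $s>0$. System. $x\in\mathbb{R}^n$, $w\in\mathbb{R}^p$, $u\in\mathbb{R}$; $f,g:\mathbb{R}^n\to\mathbb{R}^n$, $\Delta_w:\mathbb{R}^p\times\mathbb{R}^n\to\mathbb{R}^p$, $\Delta:\mathbb{R}^p\times\mathbb{R}^n\to\mathbb{R}$ are locally Lipschitz. Cost and admissibility. $Q:\mathbb{R}^n\to\mathbb{R}$ is positive definite, $r>0$ constant. A feedback $u_0(x)$ is admissible if under $u=u_0(x)$ the system $\dot x=f(x)+g(x)u$ is globally asymptotically stable and $J(x_0)=\int_0^\infty[Q(x)+ru^2]dt$, $x(0)=x_0$, is finite. An admissible $u_0$ is given. Exact policy iteration. For $i=0,1,\dots$, $V_i$ with $V_i(0)=0$ is the solution of $0=\nabla V_i(x)[f(x)+g(x)u_i(x)]+Q(x)+ru_i(x)^2$, and $u_{i+1}(x)=-\frac1{2r}g(x)^T\nabla V_i(x)^T$. Learned policies.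 $\Omega\subset\mathbb{R}^n$ is compact with the origin in its interior; $\{\phi_j\}_{j\ge1}$ are linearly independent smooth basis functions on $\Omega$ with $\phi_j(0)=0$. $\Omega$ contains $\{x: V_{i^*}(x)\le d\}$. Using data along a trajectory $(w(t),x(t))$ of the system under an input signal $u(t)$ at times $t_0<t_1<\cdots$, put $\hat u_0=u_0$ and, iteratively, $\hat v_i=u+\Delta-\hat u_i$, $\hat V_i=\sum_{j=1}^{N_1}\hat c_{i,j}\phi_j$, $\hat u_{i+1}=\sum_{j=1}^{N_2}\hat w_{i,j}\phi_j$, where the constant weights minimize $\sum_{k=0}^l e_{i,k}^2$ with $$e_{i,k}=\sum_{j=1}^{N_1}\hat c_{i,j}[\phi_j(x(t_{k+1}))-\phi_j(x(t_k))]+\int_{t_k}^{t_{k+1}}2r\sum_{j=1}^{N_2}\hat w_{i,j}\phi_j(x)\hat v_i\,dt+\int_{t_k}^{t_{k+1}}[Q(x)+r\hat u_i^2(x)]\,dt,$$ and $N_1,N_2,l$ are sufficiently large integers. $i^*>0$ is a sufficiently large integer, such that for a prescribed tolerance $\epsilon'>0$ one has $|\hat V_i-V^*|\le\epsilon'$ and $|\hat u_{i+1}-u^*|\le\epsilon'$ on $\Omega$ for $i>i^*$ and $N_1,N_2$ large; here $V^*$, $V^*(0)=0$, solves $0=\nabla V(x)f(x)+Q(x)-\frac1{4r}[\nabla V(x)g(x)]^2$ and $u^*(x)=-\frac1{2r}g(x)^T\nabla V^*(x)^T$. Redesign functions. $\rho$ is a smooth nondecreasing function with $\rho(s)>0$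 for all $s\ge0$; $\gamma(s)=\frac12\epsilon\rho(s^2)s$ for $s\ge0$ (class $\mathcal{K}_\infty$), with $\epsilon$ the constant in (A); and $$e_{ro}(x)=\frac r2\rho^2(|x|^2)\big[\hat u_{i^*+1}(x)-u_{i^*+1}(x)\big]+\hat u_{i^*+1}(x)-u_{i^*}(x).$$ *)

(* Defs.v *)
From HB Require Import structures.
From mathcomp Require Import all_boot all_order all_algebra.
From mathcomp Require Import all_classical all_reals all_analysis.

Set Implicit Arguments.
Unset Strict Implicit.
Unset Printing Implicit Defensive.

Import Order.TTheory GRing.Theory Num.Theory.
Import numFieldNormedType.Exports.

Local Open Scope classical_set_scope.
Local Open Scope ring_scope.

(* Functions on R_+ are encoded as functions R -> R of which only the values on
   [0, +oo[ are constrained. *)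
Section comparison_functions.
Context {R : realType}.

Definition classK (a : R -> R) : Prop :=
  [/\ {within `[0, +oo[, continuous a},
      a 0 = 0 &
      forall s t, 0 <= s -> s < t -> a s < a t].

Definition classKinf (a : R -> R) : Prop :=
  classK a /\ forall M, exists2 s, 0 <= s & M < a s.

(* For [a] of class K_infinity this is the inverse of the bijection [a] of
   [0, +oo[ onto itself. *)
Definition Kinv (a : R -> R) : R -> R := 'pinv_(fun=> 0) `[0, +oo[ a.

End comparison_functions.

Section euclidean_space.
Context {R : realType}.

(* The library norm on matrices is the sup norm. *)
Definition enorm n (x : 'cV[R]_n) : R := Num.sqrt (\sum_i x i 0 ^+ 2).

Definition grad n (V : 'cV[R]_n -> R) (x : 'cV[R]_n) : 'rV[R]_n :=
  \row_j 'D_(delta_mx j 0) V x.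

Definition posdef n (h : 'cV[R]_n -> R) : Prop :=
  h 0 = 0 /\ forall x, x != 0 -> 0 < h x.

End euclidean_space.

Section regularity.
Context {R : realType}.

Definition locally_lipschitz (E F : normedModType R) (f : E -> F) : Prop :=
  forall x : E, lipschitz_on f (nbhs (x, x)).

(* Meaningful for [U] open. *)
Fixpoint Ck (E : normedModType R) (k : nat) (U : set E) (f : E -> R) : Prop :=
  if k is k'.+1 then
    (forall x, U x -> differentiable f x) /\
    (forall v, Ck k' U (fun x => 'D_v f x))
  else forall x, U x -> {for x, continuous f}.

Definition C1 (E : normedModType R) (f : E -> R) : Prop := Ck 1 setT f.

(* Smoothness on a set that need not be open: C^infinity on a neighbourhood. *)
Definition smooth_on (E : normedModType R) (A : set E) (f : E -> R) : Prop :=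
  exists U : set E, [/\ open U, A `<=` U & forall k, Ck k U f].

End regularity.

(* All notions below depend on the norm of [E] only through its topology. *)
Section stability.
Context {R : realType} {E : normedModType R}.

(* For continuous [F] the equation then also holds at t = 0, with a one-sided
   derivative. *)
Definition solution (F : E -> E) (z0 : E) (z : R -> E) : Prop :=
  [/\ z 0 = z0,
      {within `[0, +oo[, continuous z} &
      forall t : R, 0 < t -> is_derive t 1 z (F (z t))].

Definition stable (F : E -> E) : Prop :=
  forall e : R, 0 < e -> exists2 delta : R, 0 < delta &
    forall z0, `|z0| < delta ->
      (exists z, solution F z0 z) /\
      (forall z, solution F z0 z -> forall t, 0 <= t -> `|z t| < e).

Definition region_of_attraction (F : E -> E) : set E :=
  [set z0 | (exists z, solution F z0 z) /\
            (forall z, solution F z0 z -> z t @[t --> +oo] --> (0 : E))].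

Definition asymptotically_stable (F : E -> E) : Prop :=
  stable F /\ nbhs (0 : E) (region_of_attraction F).

Definition globally_asymptotically_stable (F : E -> E) : Prop :=
  stable F /\ region_of_attraction F = setT.

End stability.

Section policy_iteration.
Context {R : realType} {n : nat}.
Notation X := 'cV[R]_n.
Implicit Types (f g : X -> X) (Q V u : X -> R) (r : R).

Definition nominal f g u (x : X) : X := f x + u x *: g x.

Definition admissible f g Q r u : Prop :=
  globally_asymptotically_stable (nominal f g u) /\
  forall (x0 : X) (x : R -> X), solution (nominal f g u) x0 x ->
    (\int[@lebesgue_measure R]_(t in `[0%R, +oo[)
        (Q (x t) + r * u (x t) ^+ 2)%:E < +oo)%E.

Definition improved g r V (x : X) : R :=
  - (1 / (2 * r)) * ((g x)^T *m (grad V x)^T) 0 0.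

Definition policy g r u0 (V : nat -> X -> R) (i : nat) : X -> R :=
  if i is k.+1 then improved g r (V k) else u0.

Definition policy_evaluation f g Q r u V : Prop :=
  [/\ C1 V, V 0 = 0 &
      forall x, 0 = (grad V x *m nominal f g u x) 0 0 + Q x + r * u x ^+ 2].

Definition HJB f g Q r V : Prop :=
  [/\ C1 V, V 0 = 0 &
      forall x, 0 = (grad V x *m f x) 0 0 + Q x
                    - 1 / (4 * r) * ((grad V x *m g x) 0 0) ^+ 2].

End policy_iteration.

Section learning.
Context {R : realType} {n p : nat}.
Notation X := 'cV[R]_n.
Notation Z := ('cV[R]_p * 'cV[R]_n)%type.
Notation leb := (@lebesgue_measure R).

(* The basis functions are indexed from 0. *)
Definition lincomb (phi : nat -> X -> R) N (c : 'rV[R]_N) (x : X) : R :=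
  \sum_(j < N) c 0 j * phi j x.

Definition lin_indep_on (Om : set X) (phi : nat -> X -> R) : Prop :=
  forall N (c : 'rV[R]_N), (forall x, Om x -> lincomb phi c x = 0) -> c = 0.

Definition learned_policy (u0 : X -> R) (phi : nat -> X -> R) N
    (what : nat -> 'rV[R]_N) (i : nat) : X -> R :=
  if i is k.+1 then lincomb phi (what k) else u0.

(* Solution on [a, b] under a merely integrable input [u], hence in integrated
   form. *)
Definition driven_trajectory (Dw : Z -> 'cV[R]_p) (D : Z -> R) (f g : X -> X)
    (a b : R) (u : R -> R) (w : R -> 'cV[R]_p) (x : R -> X) : Prop :=
  [/\ leb.-integrable `[a, b] (EFin \o u),
      {within `[a, b], continuous w},
      {within `[a, b], continuous x},
      forall t i, a <= t <= b ->
        w t i 0 = w a i 0 + \int[leb]_(s in `[a, t]) Dw (w s, x s) i 0 &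
      forall t i, a <= t <= b ->
        x t i 0 = x a i 0 + \int[leb]_(s in `[a, t])
          (f (x s) + (u s + D (w s, x s)) *: g (x s)) i 0].

Definition residual (Q : X -> R) (r : R) (D : Z -> R) (phi : nat -> X -> R)
    (tm : nat -> R) (u : R -> R) (w : R -> 'cV[R]_p) (x : R -> X)
    (ui : X -> R) N1 N2 (c : 'rV[R]_N1) (v : 'rV[R]_N2) (k : nat) : R :=
  \sum_(j < N1) c 0 j * (phi j (x (tm k.+1)) - phi j (x (tm k)))
  + \int[leb]_(s in `[tm k, tm k.+1])
      (2 * r * lincomb phi v (x s) * (u s + D (w s, x s) - ui (x s)))
  + \int[leb]_(s in `[tm k, tm k.+1]) (Q (x s) + r * ui (x s) ^+ 2).

Definition least_squares (Q : X -> R) (r : R) (D : Z -> R)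
    (phi : nat -> X -> R) (tm : nat -> R) (l : nat) (u : R -> R)
    (w : R -> 'cV[R]_p) (x : R -> X)
    (ui : X -> R) N1 N2 (c : 'rV[R]_N1) (v : 'rV[R]_N2) : Prop :=
  forall (c' : 'rV[R]_N1) (v' : 'rV[R]_N2),
    \sum_(k < l.+1) residual Q r D phi tm u w x ui c v k ^+ 2 <=
    \sum_(k < l.+1) residual Q r D phi tm u w x ui c' v' k ^+ 2.

End learning.

Section redesign.
Context {R : realType} {n p : nat}.
Notation X := 'cV[R]_n.
Notation Z := ('cV[R]_p * 'cV[R]_n)%type.

Definition redesign_gain (eps : R) (rho : R -> R) (s : R) : R :=
  1 / 2 * eps * rho (s ^+ 2) * s.

(* [uh], [u'] and [ui] stand for \hat u_{i+1}, u_{i+1} and u_i. *)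
Definition redesign_error (r : R) (rho : R -> R) (uh u' ui : X -> R)
    (x : X) : R :=
  r / 2 * rho (enorm x ^+ 2) ^+ 2 * (uh x - u' x) + uh x - ui x.

Definition robust_policy (r : R) (rho : R -> R) (uh : X -> R) (x : X) : R :=
  (1 + r / 2 * rho (enorm x ^+ 2) ^+ 2) * uh x.

Definition closed_loop (Dw : Z -> 'cV[R]_p) (D : Z -> R) (f g : X -> X)
    (u : X -> R) (z : Z) : Z :=
  (Dw z, f z.2 + (u z.2 + D z) *: g z.2).

End redesign.

(* Main.v *)
Require Import Defs.
From HB Require Import structures.
From mathcomp Require Import all_boot all_order all_algebra.
From mathcomp Require Import all_classical all_reals all_analysis.
From mathcomp Require Import ring lra.
Import Order.TTheory GRing.Theory Num.Theory.
Import numFieldNormedType.Exports.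
Local Open Scope classical_set_scope.
Local Open Scope ring_scope.
Set Implicit Arguments.
Unset Strict Implicit.
Unset Printing Implicit Defensive.

(** Write V for V_{i*}. Completing a square in the policy evaluation equation
    shows that V decreases along the closed loop as long as |e_ro| and |Delta|
    are at most gamma(|x|), since then
    dV/dt <= - Q + (Delta + e_ro)^2 / rho^2 <= - (Q - eps^2 |x|^2).
    Hence V decreases where it dominates a gain of W, and W decreases where it
    dominates a gain of V; the small-gain condition lets a class K_infinity
    function sigma be inserted between the two gains. Then the sets
    {V <= c, W <= sigma(c)}, 0 < c <= d, are forward invariant, they form a basis
    of neighbourhoods of the origin, and every trajectory starting in the largest
    one eventually enters each of them. The feedback is only known to be
    continuous near Omega, so solutions are obtained as limits, along an
    ultrafilter, of Euler polygons of a bounded modification of the vector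
    field; invariance shows that they solve the original equation. *)

(** * Comparison functions *)

Section class_K.
Context {R : realType}.
Implicit Types a b : R -> R.

(** The absolute value maps the line onto the half-line and fixes it pointwise, so continuity on
    [[0, +oo[] can be handled as plain continuity, without subspace topologies. *)
Lemma continuous_within_normE a :
  {within `[0, +oo[, continuous a} <-> continuous (fun s : R => a `|s|).
Proof.
split=> [ca s|ca].
  have As : (`[0, +oo[%classic : set R) `|s| by rewrite /= in_itv/= normr_ge0.
  move/subspace_continuousP : ca => /(_ _ As); apply: cvg_trans => P /=.
  move=> aP; have := @norm_continuous _ R s _ aP.
  by apply: (@filterS _ (nbhs s)) => t /=; apply; rewrite /= in_itv/= normr_ge0.
apply: (@subspace_eq_continuous _ _ _ (fun s : R => a `|s|)).
  by move=> t; rewrite inE/= in_itv/= andbT => t0; rewrite ger0_norm.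
exact: continuous_subspaceT.
Qed.

Lemma classK_le a s t : classK a -> 0 <= s -> s <= t -> a s <= a t.
Proof.
by case=> _ _ ai s0; rewrite le_eqVlt => /predU1P[->//|st]; exact/ltW/ai.
Qed.

Lemma classK_ge0 a s : classK a -> 0 <= s -> 0 <= a s.
Proof. by move=> aK s0; have [_ <- _] := aK; exact: classK_le. Qed.

Lemma classK_gt0 a s : classK a -> 0 < s -> 0 < a s.
Proof. by case=> _ a0 ai s0; rewrite -a0; exact: ai. Qed.

Lemma classK_comp a b : classK a -> classK b -> classK (b \o a).
Proof.
move=> aK bK; have [ca a0 ai] := aK; have [cb b0 bi] := bK; split.
- apply/continuous_within_normE => s.
  have -> : (fun s : R => (b \o a) `|s|) =
      (fun s : R => b `|s|) \o (fun s : R => a `|s|).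
    by apply/funext => t /=; rewrite (ger0_norm (classK_ge0 aK _)).
  apply: continuous_comp; first exact/(continuous_within_normE a).1.
  exact/(continuous_within_normE b).1.
- by rewrite /= a0.
- by move=> s t s0 st /=; apply: bi; [exact: classK_ge0|exact: ai].
Qed.

Lemma classKinf_ivt a y : classKinf a -> 0 <= y -> exists2 s, 0 <= s & a s = y.
Proof.
move=> [aK ub] y0; have [ca a0 ai] := aK; have [M M0 yM] := ub y.
have [//||s] := @IVT R a 0 M y M0.
- by apply: continuous_subspaceW ca => s /=; rewrite !in_itv/= andbT => /andP[].
- have aM := ltW (le_lt_trans y0 yM).
  by rewrite a0 (min_idPl aM) (max_idPr aM) y0 ltW.
by rewrite in_itv/= => /andP[s0 _] <-; exists s.
Qed.

Lemma classKinf_comp a b : classKinf a -> classKinf b -> classKinf (b \o a).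
Proof.
move=> aK bK; split; first exact: classK_comp aK.1 bK.1.
move=> M; have [s s0 Ms] := bK.2 M; have [t t0 ts] := classKinf_ivt aK s0.
by exists t => //=; rewrite ts.
Qed.

(** A monotone function without gaps in its range has no jumps: points where the values [a s0 + e]
    and [a s0 - e] are attained bound a neighbourhood of [s0]. If the lower value is negative,
    [0 <= a] replaces it. *)
Lemma classKinf_of_surj a : a 0 = 0 ->
  (forall s t, 0 <= s -> s < t -> a s < a t) ->
  (forall y, 0 <= y -> exists2 s, 0 <= s & a s = y) -> classKinf a.
Proof.
move=> a0 ai asurj.
have ale s t : 0 <= s -> s <= t -> a s <= a t.
  by move=> s0; rewrite le_eqVlt => /predU1P[->//|st]; exact/ltW/ai.
have age s : 0 <= s -> 0 <= a s by move=> s0; rewrite -a0 ale.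
split; last first.
  move=> M; have [|s s0 sM] := asurj (`|M| + 1); first by rewrite addr_ge0.
  by exists s => //; rewrite sM; apply: (le_lt_trans (ler_norm M)); rewrite ltrDl.
split=> //; apply/continuous_within_normE => s0.
have s00 := normr_ge0 s0.
apply/cvgrPdist_lt => e e0.
have up : exists2 d, 0 < d &
    forall s, 0 <= s -> s < `|s0| + d -> a s < a `|s0| + e.
  have [|u u0 ue] := asurj (a `|s0| + e); first by rewrite addr_ge0 ?age// ltW.
  have su : `|s0| < u.
    by rewrite ltNge; apply/negP => /(ale _ _ u0); rewrite ue gerDl leNgt e0.
  exists (u - `|s0|); rewrite ?subr_gt0// => s sge; rewrite addrC subrK -ue.
  exact: ai.
have lo : exists2 d, 0 < d &
    forall s, 0 <= s -> `|s0| - d < s -> a `|s0| - e < a s.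
  have [ne|le] := ltP (a `|s0| - e) 0.
    by exists 1 => // s sge _; rewrite (lt_le_trans ne)// age.
  have [u u0 ue] := asurj _ le.
  have su : u < `|s0|.
    by rewrite ltNge; apply/negP => /(ale _ _ s00); rewrite ue lerBrDr gerDl leNgt e0.
  exists (`|s0| - u); rewrite ?subr_gt0// => s sge; rewrite opprB addrC subrK -ue.
  exact: ai.
have [d1 d10 h1] := up; have [d2 d20 h2] := lo.
apply/nbhs_ballP; exists (Num.min d1 d2) => /=; first by rewrite lt_min d10.
move=> t; rewrite /ball/= lt_min => /andP[t1 t2] /=.
have l1 : `|t| < `|s0| + d1.
  by rewrite -ltrBlDl (le_lt_trans _ t1)// distrC lerB_dist.
have l2 : `|s0| - d2 < `|t|.
  by rewrite ltrBlDr -ltrBlDl (le_lt_trans _ t2)// lerB_dist.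
rewrite distrC ltr_norml ltrBlDl h1// andbT ltrBrDr addrC.
exact: h2.
Qed.

(** * Inverses of class K-infinity functions *)

Section Kinv.
Variable a : R -> R.
Hypothesis aK : classKinf a.

Lemma Kinv_rangeP y : 0 <= y -> 0 <= Kinv a y /\ a (Kinv a y) = y.
Proof.
move=> y0; have aS : set_surj `[0, +oo[ `[0, +oo[ a.
  move=> z /=; rewrite in_itv/= andbT => z0.
  by have [s s0 <-] := classKinf_ivt aK z0; exists s => //=; rewrite in_itv/= s0.
have yin : (`[0, +oo[%classic : set R) y by rewrite /= in_itv/= y0.
split; last by apply: (surjpK _ aS); rewrite inE.
have /(_ (Kinv a y)) := @surjpinv_image_sub _ _ (fun=> 0) _ _ _ aS.
by rewrite /= in_itv/= andbT; apply; exists y.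
Qed.

Lemma Kinv_ge0 y : 0 <= y -> 0 <= Kinv a y.
Proof. by move=> /Kinv_rangeP[]. Qed.

Lemma KinvK y : 0 <= y -> a (Kinv a y) = y.
Proof. by move=> /Kinv_rangeP[]. Qed.

Lemma Kinv_lt s t : 0 <= s -> s < t -> Kinv a s < Kinv a t.
Proof.
move=> s0 st; have t0 : 0 <= t by rewrite (le_trans s0) ?ltW.
rewrite ltNge; apply/negP => /(classK_le aK.1 (Kinv_ge0 t0)).
by rewrite !KinvK// leNgt st.
Qed.

Lemma Kinv_can s : 0 <= s -> Kinv a (a s) = s.
Proof.
move=> s0; have as0 := classK_ge0 aK.1 s0; have [_ _ ai] := aK.1.
have k0 := Kinv_ge0 as0; have ek := KinvK as0.
by case: (ltgtP (Kinv a (a s)) s) => // /ai; rewrite ek ltxx;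
  [move/(_ k0)|move/(_ s0)].
Qed.

Lemma classKinf_Kinv : classKinf (Kinv a).
Proof.
apply: classKinf_of_surj; last 1 first.
- by move=> y y0; exists (a y); [exact: classK_ge0 aK.1 y0|exact: Kinv_can].
- by rewrite -{1}(_ : a 0 = 0) ?Kinv_can//; case: aK => -[].
- exact: Kinv_lt.
Qed.

End Kinv.

Lemma classKinf_ge a b : classK a -> (forall s, 0 <= s -> b s <= a s) ->
  classKinf b -> classKinf a.
Proof.
move=> aK ba [_ bub]; split=> // M; have [s s0 Ms] := bub M.
by exists s => //; rewrite (lt_le_trans Ms)// ba.
Qed.

Lemma classKinf_id : classKinf (@id R).
Proof. by apply: classKinf_of_surj => // y y0; exists y. Qed.

Lemma classKD a b : classK a -> classK b -> classK (a \+ b).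
Proof.
move=> [ca a0 ai] [cb b0 bi]; split => /=.
- apply/continuous_within_normE => s; apply: cvgD.
  + exact/(continuous_within_normE a).1.
  + exact/(continuous_within_normE b).1.
- by rewrite a0 b0 addr0.
- by move=> s t s0 st; rewrite ltrD ?ai ?bi.
Qed.

Lemma classKZ a k : 0 < k -> classK a -> classK (fun s => k * a s).
Proof.
move=> k0 [ca a0 ai]; split => /=.
- apply/continuous_within_normE => s; apply: cvgMl_tmp.
  exact/(continuous_within_normE a).1.
- by rewrite a0 mulr0.
- by move=> s t s0 st; rewrite ltr_pM2l ?ai.
Qed.

Lemma classK_max a b : classK a -> classK b -> classK (a \max b).
Proof.
move=> [ca a0 ai] [cb b0 bi]; split => /=.
- apply/continuous_within_normE => s.
  apply: (@continuous_max _ _ (fun s => a `|s|) (fun s => b `|s|)).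
  + exact/(continuous_within_normE a).1.
  + exact/(continuous_within_normE b).1.
- by rewrite a0 b0 maxxx.
- by move=> s t s0 st; rewrite gt_max !lt_max ai ?bi// orbT.
Qed.

(* With [h] the inverse of [max(A, G o (B + id)^-1)] composed with [G], one has
   [B < h] and [A o h <= G]; the mean of [B] and [h] lies strictly between. *)
Lemma small_gain_interpolation (A B G : R -> R) :
  classK A -> classK B -> classKinf G ->
  (forall s, 0 < s -> A (B s) < G s) ->
  exists2 sigma, classKinf sigma &
    forall s, 0 < s -> B s < sigma s /\ A (sigma s) < G s.
Proof.
move=> AK BK GK ABG.
(* Adding the identity makes [B] unbounded, hence invertible, and strictly larger at positive
   arguments, which yields [m (B s) < G s]. *)
have BidK : classKinf (B \+ id).
  apply: (@classKinf_ge _ id) classKinf_id; first exact: classKD classKinf_id.1.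
  by move=> s s0 /=; rewrite lerDr classK_ge0.
pose m := G \o Kinv (B \+ id).
have mK : classKinf m := classKinf_comp (classKinf_Kinv BidK) GK.
(* [A] may be bounded; its maximum with [m] is unbounded and can be inverted. *)
have A'K : classKinf (A \max m).
  apply: (classKinf_ge _ _ mK); first exact: classK_max mK.1.
  by move=> s s0; rewrite /= le_max lexx orbT.
pose h := Kinv (A \max m) \o G.
have hK : classKinf h := classKinf_comp GK (classKinf_Kinv A'K).
have Bh s : 0 < s -> B s < h s.
  move=> s0; have s0' := ltW s0; have Bs0 := classK_ge0 BK s0'.
  rewrite -(Kinv_can A'K Bs0); apply: Kinv_lt => //.
    exact: classK_ge0 A'K.1 Bs0.
  rewrite /= gt_max ABG//= /m/=; have [_ _ Gi] := GK.1; apply: Gi.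
    exact: Kinv_ge0.
  rewrite -[ltRHS](Kinv_can BidK)//; apply: Kinv_lt => //=.
  by rewrite ltrDl.
exists (fun s => 2^-1 * (B s + h s)).
  apply: (@classKinf_ge _ (fun s => 2^-1 * h s)).
  - by apply: classKZ => //; apply: classKD hK.1.
  - by move=> s s0; rewrite ler_pM2l// lerDr classK_ge0.
  - split; first by apply: classKZ hK.1.
    move=> M; have [s s0 Ms] := hK.2 (2 * M); exists s => //.
    by lra.
move=> s s0; have Bhs := Bh _ s0.
have sh : 2^-1 * (B s + h s) < h s by lra.
split; first by lra.
have sig0 : 0 <= 2^-1 * (B s + h s).
  by have := classK_ge0 BK (ltW s0); have := classK_ge0 hK.1 (ltW s0); lra.
have [_ _ Ai] := AK; apply: (lt_le_trans (Ai _ _ sig0 sh)).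
have Gs : 0 <= G s by apply: classK_ge0 GK.1 (ltW s0).
by rewrite -[leRHS](KinvK A'K Gs) /= le_max lexx.
Qed.

End class_K.

(** * Existence of solutions: limits of Euler polygons *)

Section ultra.

(** Compactness gives a cluster point, and an ultrafilter converges to each of its cluster points:
    it contains every set or its complement, and the complement of a neighbourhood is ruled out. *)
Lemma ultra_cvg_compact (I : Type) (T : topologicalType) (U : set_system I)
    (f : I -> T) (A : set T) : UltraFilter U -> compact A ->
  (forall i, A (f i)) -> exists p : T, f @ U --> p.
Proof.
move=> UU cA fA; have UA : (f @ U) A by exact: (@filterE _ U _ (f @^-1` A)).
have [p [_ cp]] := cA _ _ UA.
exists p => B pB; have [//|UB] := in_ultra_setVsetC (f @^-1` B) UU.
by have [y []] := cp (~` B) B UB pB.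
Qed.

End ultra.

Section euler.
Context {R : realType} {E : normedModType R}.
Variables (G : E -> E) (M : R) (z0 : E).
Hypothesis G_le : forall y, `|G y| <= M.

Let h k : R := k.+1%:R^-1.
Let euler k j : E := iter j (fun y => y + h k *: G y) z0.
Let idx k (t : R) : nat := Num.truncn (t * k.+1%:R).
(** A step function, constant between grid times and equal to [z0] at negative times. Its jumps are
    at most [M * h k], so the limit is the same as for interpolated polygons. *)
Let poly k t : E := euler k (idx k t).

Let h_gt0 k : 0 < h k. Proof. by rewrite invr_gt0. Qed.

Let M_ge0 : 0 <= M. Proof. exact: le_trans (G_le z0). Qed.

(** Each step deviates from the constant slope [c] by at most [eta * h k], and the deviations add
    up. The choice [c = 0] gives Lipschitz bounds, [c = G a] the derivative. *)
Let eulerD k i j c eta :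
  (forall l, (j <= l < j + i)%N -> `|G (euler k l) - c| <= eta) ->
  `|euler k (j + i) - euler k j - (i%:R * h k) *: c| <= eta * (i%:R * h k).
Proof.
elim: i => [|i IH] H.
  by rewrite addn0 subrr mul0r scale0r subr0 normr0 mulr0.
have {}IH : `|euler k (j + i) - euler k j - (i%:R * h k) *: c| <=
    eta * (i%:R * h k).
  by apply: IH => l /andP[jl li]; apply: H; rewrite jl addnS ltnS ltnW.
have Hi : `|G (euler k (j + i)) - c| <= eta.
  by apply: H; rewrite leq_addr addnS ltnSn.
rewrite addnS [euler k (j + i).+1]/= -/(euler k (j + i)).
have -> : euler k (j + i) + h k *: G (euler k (j + i)) - euler k j -
    (i.+1%:R * h k) *: c = (euler k (j + i) - euler k j - (i%:R * h k) *: c) +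
    h k *: (G (euler k (j + i)) - c).
  rewrite -natr1 mulrDl mul1r scalerDl scalerBr opprD !addrA.
  by congr (_ - _); rewrite [RHS]addrAC; congr (_ - _); exact: addrAC.
rewrite (le_trans (ler_normD _ _))// -natr1 mulrDl mul1r mulrDr lerD//.
by rewrite normrZ gtr0_norm// mulrC ler_wpM2r// ltW.
Qed.

Let idx_itv k t : 0 <= t -> (idx k t)%:R * h k <= t < (idx k t)%:R * h k + h k.
Proof.
move=> t0; have /truncn_itv : 0 <= t * k.+1%:R by rewrite mulr_ge0.
rewrite -/(idx k t) => /andP[a b]; apply/andP; split.
  by rewrite /h ler_pdivrMr ?ltr0n.
by rewrite -[X in _ + X]mul1r -mulrDl natr1 /h ltr_pdivlMr ?ltr0n.
Qed.

Let idx_le k s t : s <= t -> (idx k s <= idx k t)%N.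
Proof. by move=> st; apply: le_truncn; rewrite ler_wpM2r. Qed.

(** Rounding [s] and [t] to the grid changes the elapsed time by at most [h k], which accounts for
    the last term. *)
Let polyB k s t c eta : 0 <= s -> s <= t ->
  (forall l, (idx k s <= l < idx k t)%N -> `|G (euler k l) - c| <= eta) ->
  0 <= eta ->
  `|poly k t - poly k s - (t - s) *: c| <=
    eta * (t - s) + (eta + `|c|) * h k.
Proof.
move=> s0 st H eta0; have t0 := le_trans s0 st.
have /andP[s1 s2] := idx_itv k s0; have /andP[t1 t2] := idx_itv k t0.
have ist := idx_le k st.
have := @eulerD k (idx k t - idx k s) (idx k s) c eta.
rewrite subnKC// => /(_ H); rewrite -/(poly k t) -/(poly k s) natrB// => H'.
set m := _ * h k in H'.
have mE : m = (idx k t)%:R * h k - (idx k s)%:R * h k by rewrite /m mulrBl.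
have -> : poly k t - poly k s - (t - s) *: c =
  (poly k t - poly k s - m *: c) + (m - (t - s)) *: c.
  by rewrite (scalerBl m) addrA subrK.
rewrite (le_trans (ler_normD _ _))// normrZ.
have mst : `|m - (t - s)| <= h k by rewrite ler_norml mE; lra.
have mle : m <= t - s + h k by move: mst; rewrite ler_norml => /andP[]; lra.
have e1 : eta * m <= eta * (t - s + h k) by rewrite ler_wpM2l.
have e2 : `|m - (t - s)| * `|c| <= h k * `|c| by rewrite ler_wpM2r.
by move: H' e1 e2; rewrite mulrDr mulrDl (mulrC (h k)); lra.
Qed.

Let poly_lip k s t : 0 <= s -> s <= t ->
  `|poly k t - poly k s| <= M * (t - s) + M * h k.
Proof.
move=> s0 st; have := @polyB k s t 0 M s0 st.
rewrite scaler0 subr0 normr0 addr0; apply => // l _.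
by rewrite subr0.
Qed.

Let euler_near k s t l : 0 <= s -> s <= t -> (idx k s <= l <= idx k t)%N ->
  `|euler k l - poly k s| <= M * (t - s) + M * h k.
Proof.
move=> s0 st /andP[sl lt].
have /andP[s1 s2] := idx_itv k s0.
have /andP[t1 t2] := idx_itv k (le_trans s0 st).
have := @eulerD k (l - idx k s) (idx k s) 0 M.
rewrite subnKC// scaler0 subr0 => /(_ _)/le_trans -> //.
  by move=> i _; rewrite subr0.
rewrite -mulrDr ler_wpM2l// natrB// mulrBl.
have : l%:R * h k <= (idx k t)%:R * h k by rewrite ler_wpM2r ?ler_nat// ltW.
by lra.
Qed.

(** The limit is taken at each time separately, along one ultrafilter, so no subsequence has to be
    extracted; the uniform estimates on [poly] pass to the limit. Only continuity of [G] at the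
    point [z t] enters the derivative at [t]. *)
Lemma euler_limit : (forall r, compact [set y : E | `|y| <= r]) ->
  exists z : R -> E,
  [/\ z 0 = z0,
      forall s t, 0 <= s -> s <= t -> `|z t - z s| <= M * (t - s) &
      forall t, 0 < t -> {for z t, continuous G} -> is_derive t 1 z (G (z t))].
Proof.
move=> cE.
have [U [UU sU]] := ultraFilterLemma eventually_filter.
have cvgz t : exists p : E, (poly^~ t) @ U --> p.
  apply: (ultra_cvg_compact UU (cE (`|z0| + (M * `|t| + M)))) => k /=.
  have z0E : z0 = poly k 0 by rewrite /poly /idx mul0r truncn0.
  have [t0|t0] := leP 0 t; last first.
    rewrite /poly /idx; have /truncn0Pn -> : ~~ (1 <= t * k.+1%:R).
      by rewrite -ltNge (lt_le_trans _ ler01)// pmulr_llt0.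
    by rewrite lerDl addr_ge0// mulr_ge0.
  rewrite -lerBlDl (le_trans (lerB_dist _ _))// z0E.
  rewrite (le_trans (poly_lip _ _ _))// subr0 ger0_norm// lerD2l ler_piMr//.
  by rewrite invf_le1// ler1n.
pose z t := sval (cid (cvgz t)).
have zP t : (poly^~ t) @ U --> z t by exact: svalP (cid (cvgz t)).
(* A single index serves both times and a small step size at once, because members of a filter
   intersect. *)
have approx s t e : 0 < e ->
    exists k, [/\ h k < e, `|z s - poly k s| < e & `|z t - poly k t| < e].
  move=> e0.
  have hU : U [set k | h k < e].
    by apply: sU; exact: (near_infty_natSinv_lt (PosNum e0)).
  have /cvgrPdist_lt /(_ _ e0) sU' := zP s.
  have /cvgrPdist_lt /(_ _ e0) tU' := zP t.
  have [k [[? ?] ?]] := filter_ex (filterI (filterI hU sU') tU').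
  by exists k.
have z_lip s t : 0 <= s -> s <= t -> `|z t - z s| <= M * (t - s).
  move=> s0 st; apply/ler_addgt0Pr => e e0.
  have e'0 : 0 < e / (M + 2) by rewrite divr_gt0// ltr_wpDl.
  have [k [hk sk tk]] := approx s t _ e'0.
  have := poly_lip k s0 st.
  have -> : z t - z s = (z t - poly k t) + (poly k t - poly k s) - (z s - poly k s).
    by rewrite opprB !subrKA.
  have eE : (M + 2) * (e / (M + 2)) = e by rewrite mulrC divfK// gt_eqF// ltr_wpDl.
  have : M * h k <= M * (e / (M + 2)) by rewrite ler_wpM2l// ltW.
  have := ler_normB ((z t - poly k t) + (poly k t - poly k s)) (z s - poly k s).
  have := ler_normD (z t - poly k t) (poly k t - poly k s).
  move: eE sk tk; rewrite mulrDl; lra.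
(* Speed at most [M] keeps the curve within [delta] of [a] on the whole interval, where the slope is
   within [eta] of [G a]. *)
have z_diff s t a eta delta : 0 <= eta ->
    (forall y, `|y - a| < delta -> `|G y - G a| <= eta) ->
    0 <= s -> s <= t -> `|z s - a| + M * (t - s) < delta ->
    `|z t - z s - (t - s) *: G a| <= eta * (t - s).
  move=> eta0 Gd s0 st dl; apply/ler_addgt0Pr => e e0.
  (* [C] dominates [M + eta + 2], the factor in the total approximation error, and [M + 1], the
     factor in the drift of the nodes; the first must stay below [e], the second below the slack
     [sl]. *)
  pose C := M + eta + 2 + M.
  have C0 : 0 < C by rewrite /C; have := M_ge0; lra.
  pose sl := delta - (`|z s - a| + M * (t - s)).
  have sl0 : 0 < sl by rewrite subr_gt0.
  have e'0 : 0 < Num.min e sl / C by rewrite divr_gt0// lt_min e0.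
  have [k [hk sk tk]] := approx s t _ e'0.
  have e'C : (Num.min e sl / C) * C = Num.min e sl by rewrite divfK// gt_eqF.
  have me : Num.min e sl <= e by rewrite ge_min lexx.
  have ms : Num.min e sl <= sl by rewrite ge_min lexx orbT.
  have Mh : M * h k <= M * (Num.min e sl / C) by rewrite ler_wpM2l// ltW.
  have Hl l : (idx k s <= l < idx k t)%N -> `|G (euler k l) - G a| <= eta.
    move=> /andP[sl1 sl2]; apply: Gd.
    have := @euler_near k s t l s0 st; rewrite sl1 (ltnW sl2) => /(_ isT).
    have -> : euler k l - a = (euler k l - poly k s) - (z s - poly k s) + (z s - a).
      by rewrite opprB !subrKA.
    have := ler_normB (euler k l - poly k s) (z s - poly k s).
    have := ler_normD (euler k l - poly k s - (z s - poly k s)) (z s - a).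
    have : (M + 1) * (Num.min e sl / C) <= sl.
      rewrite (le_trans _ ms)// -{2}e'C mulrC ler_wpM2l ?(ltW e'0)//.
      by rewrite /C; have := M_ge0; lra.
    rewrite /sl mulrDl mul1r; lra.
  have := polyB s0 st Hl eta0.
  have -> : z t - z s - (t - s) *: G a = (z t - poly k t) +
    (poly k t - poly k s - (t - s) *: G a) - (z s - poly k s).
    rewrite opprB -(addrA (poly k t)) subrKA -!addrA; congr (_ + _).
    by rewrite [RHS]addrCA addKr addrC.
  set X := poly k t - poly k s - _.
  have := ler_normB ((z t - poly k t) + X) (z s - poly k s).
  have := ler_normD (z t - poly k t) X.
  have : (eta + `|G a|) * h k <= (eta + M) * (Num.min e sl / C).
    by rewrite ler_pM ?addr_ge0 ?lerD// ltW.
  have : (M + eta + 2) * (Num.min e sl / C) <= e.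
    rewrite (le_trans _ me)// -{2}e'C mulrC ler_wpM2l ?(ltW e'0)//.
    by rewrite /C; have := M_ge0; lra.
  have -> : (M + eta + 2) * (Num.min e sl / C) =
    (eta + M) * (Num.min e sl / C) + 2 * (Num.min e sl / C) by ring.
  lra.
exists z; split => //.
- have : (poly^~ 0) @ U --> z0.
    by apply: cvg_near_cst; apply: filterE => k; rewrite /poly /idx mul0r truncn0.
  by move=> z0P; exact: (norm_cvg_unique (zP 0) z0P).
- move=> T T0 cG.
  have cvgd : h0^-1 *: (z (h0 *: 1 + T) - z T) @[h0 --> 0^'] --> G (z T).
    apply/cvgrPdist_le => eta eta0.
    have /cvgrPdist_le /(_ _ eta0) /nbhs_normP[delta /= delta0 Hd] := cG.
    have Gd y : `|y - z T| < delta -> `|G y - G (z T)| <= eta.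
      by move=> yd; rewrite distrC; apply: Hd; rewrite /= distrC.
    (* The bound by [T] keeps [x + T] nonnegative. For negative [x] the estimate starts at [x + T],
       already up to [M] times the length away from [z T], and may drift as far again: hence
       [2 * M]. *)
    have D0 : 0 < Num.min T (delta / (2 * M + 1)).
      by rewrite lt_min T0 divr_gt0//; have := M_ge0; lra.
    rewrite near_withinE; apply/nbhs_ballP.
    exists (Num.min T (delta / (2 * M + 1))) => // x.
    rewrite /ball/= sub0r normrN lt_min => /andP[xT xd] x0.
    have xd' : 2 * M * `|x| < delta.
      move: xd; rewrite ltr_pdivlMr; last by have := M_ge0; lra.
      by rewrite mulrC mulrDl mul1r; have := normr_ge0 x; lra.
    have key : `|z (x + T) - z T - x *: G (z T)| <= eta * `|x|.
      have [xp|xn] := ltP 0 x.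
        have -> : x *: G (z T) = (x + T - T) *: G (z T) by rewrite addrK.
        have -> : eta * `|x| = eta * (x + T - T) by rewrite addrK gtr0_norm.
        apply: (z_diff _ _ _ _ delta) => //; rewrite ?(ltW eta0) ?(ltW T0)//.
          by rewrite lerDr ltW.
        rewrite subrr normr0 add0r addrK; move: xd'; rewrite gtr0_norm//.
        by have := M_ge0; have : 0 <= M * x; [rewrite mulr_ge0// ltW|lra].
      have xN : `|x| = - x by rewrite ler0_norm.
      have -> : z (x + T) - z T - x *: G (z T) =
        - (z T - z (x + T) - (T - (x + T)) *: G (z T)).
        by rewrite (_ : T - (x + T) = - x) ?scaleNr ?opprK ?opprD ?opprK 1?[- _ + z _]addrC//; ring.
      have -> : eta * `|x| = eta * (T - (x + T)) by rewrite xN; congr (_ * _); ring.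
      rewrite normrN; apply: (z_diff _ _ _ _ delta) => //.
      - exact: ltW.
      - by move: xT; rewrite xN; lra.
      - by lra.
      - have := @z_lip (x + T) T.
        have -> : T - (x + T) = `|x| by rewrite xN; ring.
        have xT0 : 0 <= x + T by move: xT; rewrite xN; lra.
        rewrite distrC => /(_ xT0); rewrite gerDr => /(_ xn).
        by move: xd'; lra.
    have -> : G (z T) - x^-1 *: (z (x *: 1 + T) - z T) =
        - (x^-1 *: (z (x + T) - z T - x *: G (z T))).
      by rewrite [x *: 1]mulr1 -[RHS]scalerN opprB [RHS]scalerBr scalerA mulVf// scale1r.
    rewrite normrN normrZ normfV ler_pdivrMl ?normr_gt0// mulrC.
    exact: key.
  apply: DeriveDef; first by apply/cvg_ex; exists (G (z T)).
  exact: cvg_lim cvgd.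
Qed.

End euler.

(** * Invariance and small-gain attraction *)

Section solutions_in_a_set.
Context {R : realType} {E : normedModType R}.
Variables (O : set E) (F : E -> E).
Implicit Types (v l : E -> R) (z : R -> E).

(** The equation is imposed only while the curve is in [O]: limits of Euler polygons for a modified
    field satisfy no more than this, until invariance keeps them in [O]. *)
Definition solution_in z : Prop :=
  {within `[0, +oo[, continuous z} /\
  forall t : R, 0 < t -> O (z t) -> is_derive t 1 z (F (z t)).

(** [l] is the derivative of [v] along [F], expressed through curves rather than a gradient, so that
    functions of one component of a product fit directly. *)
Definition lie_derivative v l : Prop :=
  [/\ continuous v,
      forall y, O y -> {for y, continuous l} &
      forall z t, O (z t) -> is_derive t 1 z (F (z t)) ->
        is_derive t 1 (v \o z) (l (z t))].

Lemma solution_near z t (P : set E) : {within `[0, +oo[, continuous z} ->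
  0 <= t -> nbhs (z t) P ->
  exists2 e, 0 < e & forall s, 0 <= s -> `|s - t| < e -> P (z s).
Proof.
move=> cz t0 zP.
have tI : (`[0, +oo[%classic : set R) t by rewrite /= in_itv/= t0.
move/subspace_continuousP : cz => /(_ t tI) /(_ P zP).
rewrite /nbhs/= => -[e /= e0 He]; exists e => // s s0 st.
by apply: (He s) => /=; rewrite ?in_itv/= ?s0// distrC.
Qed.

(* [C] is reached at the infimum of the exit times because it is closed. *)
Lemma solution_stays z (C : set E) t0 : {within `[0, +oo[, continuous z} ->
  closed C -> 0 <= t0 -> C (z t0) ->
  (forall t, t0 <= t -> C (z t) ->
    exists2 e, 0 < e & forall s, t <= s -> s < t + e -> C (z s)) ->
  forall t, t0 <= t -> C (z t).
Proof.
move=> cz cC t00 Ct0 Hext t t0t; apply: contrapT => nCt.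
pose B := [set s | t0 <= s /\ ~ C (z s)].
have Binf : has_inf B by split; [exists t|exists t0 => s []].
pose T := inf B.
have t0T : t0 <= T by apply: lb_le_inf; [exists t|move=> s []].
have CT s : t0 <= s -> s < T -> C (z s).
  move=> t0s sT; apply: contrapT => nC; move: sT; rewrite ltNge => /negP; apply.
  by apply: ge_inf => //; exact: Binf.2.
have CzT : C (z T).
  have [<-//|t0T'] := eqVneq t0 T.
  have {}t0T' : t0 < T by rewrite lt_neqAle t0T'.
  apply: contrapT => nC.
  have [|e e0 He] := @solution_near z T (~` C) cz (le_trans t00 t0T).
    by apply: open_nbhs_nbhs; split => //; exact: closed_openC.
  pose s := Num.max t0 (T - e / 2).
  have t0s : t0 <= s by rewrite le_max lexx.
  have sT : s < T by rewrite gt_max t0T'/= ltrBlDr ltrDl divr_gt0.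
  have : ~ C (z s).
    apply: He; first exact: le_trans t0s.
    rewrite ltr0_norm ?subr_lt0// opprB.
    have : T - e / 2 <= s by rewrite le_max lexx orbT.
    lra.
  by apply; exact: CT.
have [e e0 He] := Hext T t0T CzT.
have [s [t0s nCs] sTe] := inf_adherent e0 Binf.
apply: (nCs); apply: He; last exact: sTe.
by apply: ge_inf; [exact: Binf.2|].
Qed.

Section lie.
Variables (v l : E -> R) (z : R -> E).
Hypotheses (vl : lie_derivative v l) (zS : solution_in z).

Lemma within_continuous_lie (A : set R) : A `<=` `[0, +oo[ ->
  {within A, continuous (v \o z)}.
Proof.
move=> A0; apply: (continuous_subspaceW A0).
apply: within_continuous_comp; last exact: zS.1.
by move=> y _; have [cv _ _] := vl; exact: cv.
Qed.

Lemma lie_mvt a b c : 0 <= a -> a < b ->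
  (forall t, a < t -> t < b -> O (z t) /\ l (z t) <= c) ->
  v (z b) - v (z a) <= c * (b - a).
Proof.
move=> a0 ab H; have [cv cl dv] := vl.
have [|||t /[!in_itv]/= /andP[at_ tb] ->] :=
    @MVT R (v \o z) (l \o z) a b.
- exact: ab.
- move=> t /[!in_itv]/= /andP[at_ tb]; apply: dv; first by have [] := H t at_ tb.
  by apply: zS.2; [exact: le_lt_trans at_|have [] := H t at_ tb].
- apply: within_continuous_lie => t /=; rewrite !in_itv/= andbT.
  by move=> /andP[+ _]; exact: le_trans.
by rewrite ler_wpM2r ?subr_ge0 ?(ltW ab)//; have [] := H t at_ tb.
Qed.

Hypothesis oO : open O.

(** Below the level, continuity suffices; on it, [l] stays negative nearby, so the mean value
    theorem prevents [v] from growing. *)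
Lemma lie_sublevel_extend a t : 0 <= t -> O (z t) -> v (z t) <= a ->
  (v (z t) = a -> l (z t) < 0) ->
  exists2 e, 0 < e & forall s, t <= s -> s < t + e -> v (z s) <= a.
Proof.
move=> t0 Ot va la; have [cv cl dv] := vl; have [cz _] := zS.
have [vlt|vge] := ltP (v (z t)) a.
  have [|e e0 He] := @solution_near z t [set y | v y < a] cz t0.
    exact: (cvgr_lt _ (cv (z t))).
  exists e => // s ts se; apply/ltW/He; first exact: le_trans ts.
  by rewrite ger0_norm ?subr_ge0// ltrBlDl.
have vE : v (z t) = a by apply/eqP; rewrite eq_le va.
have [|e e0 He] := @solution_near z t (O `&` [set y | l y < 0]) cz t0.
  apply: filterI; first by apply: open_nbhs_nbhs; split.
  exact: (cvgr_lt _ (cl _ Ot) _ (la vE)).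
exists e => // s; rewrite le_eqVlt => /predU1P[<-//|ts] se.
rewrite -subr_le0 -vE -(mul0r (s - t)); apply: lie_mvt => // tau ttau taus.
have [||? ?] := He tau; rewrite ?(le_trans t0) ?(ltW ttau)//.
  rewrite ger0_norm ?subr_ge0 ?(ltW ttau)// ltrBlDl; exact: lt_trans se.
by split=> //; exact: ltW.
Qed.

(** By compactness [l] has a negative upper bound on the part of [K] where [a <= v], so [v] reaches
    the level in finite time; the sublevel set is then never left. *)
Lemma lie_eventually_le (K : set E) a t0 : compact K -> K `<=` O ->
  (forall y, K y -> a <= v y -> l y < 0) ->
  0 <= t0 -> (forall t, t0 <= t -> K (z t)) ->
  exists2 t1, t0 <= t1 & forall t, t1 <= t -> v (z t) <= a.
Proof.
move=> cK KO Kl t00 zK; have [cv cl dv] := vl; have [cz _] := zS.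
have clv : closed [set y | a <= v y].
  exact: (@closed_comp _ _ v _ (fun y _ => cv y) (@closed_ge _ a)).
have cKa : compact (K `&` [set y | a <= v y]).
  exact: compact_closedI.
have [eta eta0 Heta] : exists2 eta, 0 < eta &
    forall y, K y -> a <= v y -> l y <= - eta.
  have [K0|/set0P/negP/negbNE/eqP K0] :=
    pselect (K `&` [set y | a <= v y] !=set0); last first.
    exists 1 => // y Ky ay; have : (K `&` [set y | a <= v y]) y by [].
    by rewrite K0.
  have [|c] := @compact_EVT_max _ R l _ K0 cKa.
    apply: continuous_in_subspaceT => y; rewrite inE => -[Ky _]; exact/cl/KO.
  rewrite inE => -[Kc ac] cmax; exists (- l c).
    by rewrite oppr_gt0 Kl.
  by move=> y Ky ay; rewrite opprK; apply: cmax; rewrite inE.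
have [t1 t01 vt1] : exists2 t1, t0 <= t1 & v (z t1) <= a.
  apply: contrapT => H.
  have va t : t0 <= t -> a < v (z t).
    by move=> t0t; rewrite ltNge; apply/negP => vt; apply: H; exists t.
  (* Decrease at rate [eta] brings [v] down to [a] by this time; the extra unit of time makes the
     contradiction strict. *)
  pose T := t0 + (v (z t0) - a) / eta + 1.
  have va0 := va _ (lexx t0).
  have q0 : 0 < (v (z t0) - a) / eta by rewrite divr_gt0// subr_gt0.
  have t0T : t0 < T by rewrite /T; lra.
  have vT : a < v (z T) by apply: va; rewrite ltW.
  have := @lie_mvt t0 T (- eta) t00 t0T.
  have -> : - eta * (T - t0) = - (v (z t0) - a) - eta.
    by rewrite /T; field; rewrite gt_eqF.
  move=> H'; suff : v (z T) - v (z t0) <= - (v (z t0) - a) - eta by lra.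
  apply: H' => t t0t _; split; first exact/KO/zK/ltW.
  by apply: Heta; [exact/zK/ltW|exact/ltW/va/ltW].
exists t1 => // t t1t; have t10 : 0 <= t1 by exact: le_trans t01.
apply: (solution_stays (C := [set y | v y <= a]) cz _ t10 vt1 _ t1t).
  exact: (@closed_comp _ _ v _ (fun y _ => cv y) (@closed_le _ a)).
move=> s t1s vs; have Ks := zK s (le_trans t01 t1s).
apply: lie_sublevel_extend => //; first exact: le_trans t1s.
  exact: KO.
by move=> vE; apply: Kl; rewrite ?vE.
Qed.

End lie.

(** * Small-gain argument for two functions with interlaced decrease conditions *)

Section small_gain.
Variables (v1 l1 v2 l2 : E -> R) (A B G sigma : R -> R) (d : R).
Hypotheses (oO : open O) (vl1 : lie_derivative v1 l1)
  (vl2 : lie_derivative v2 l2).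
Hypotheses (v1_ge0 : forall y, 0 <= v1 y) (v2_ge0 : forall y, 0 <= v2 y).
Hypotheses (AK : classK A) (BK : classK B) (GK : classK G)
  (sigmaK : classK sigma).
Hypothesis sigmaP : forall s, 0 < s -> B s < sigma s /\ A (sigma s) < G s.

Definition gain_sublevel c : set E := [set y | v1 y <= c /\ v2 y <= sigma c].

Hypotheses (KO : gain_sublevel d `<=` O) (cK : compact (gain_sublevel d)).
Hypothesis l1_lt0 : forall y, gain_sublevel d y -> 0 < v1 y ->
  A (v2 y) < G (v1 y) -> l1 y < 0.
Hypothesis l2_lt0 : forall y, gain_sublevel d y -> 0 < v2 y ->
  B (v1 y) < v2 y -> l2 y < 0.

Lemma le_gain_sublevel c c' : 0 <= c -> c <= c' ->
  gain_sublevel c `<=` gain_sublevel c'.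
Proof.
move=> c0 cc' y [y1 y2]; split; first exact: le_trans cc'.
exact/(le_trans y2)/classK_le.
Qed.

Lemma closed_gain_sublevel c : closed (gain_sublevel c).
Proof.
have [cv1 _ _] := vl1; have [cv2 _ _] := vl2.
rewrite /gain_sublevel; apply: closedI.
  exact: (@closed_comp _ _ v1 _ (fun y _ => cv1 y) (@closed_le _ c)).
exact: (@closed_comp _ _ v2 _ (fun y _ => cv2 y) (@closed_le _ (sigma c))).
Qed.

Lemma nbhs_gain_sublevel y c : v1 y < c -> v2 y < sigma c ->
  nbhs y (gain_sublevel c).
Proof.
have [cv1 _ _] := vl1; have [cv2 _ _] := vl2; move=> y1 y2.
have near1 : \forall x \near y, v1 x < c by exact: (cvgr_lt _ (cv1 y)).
have near2 : \forall x \near y, v2 x < sigma c by exact: (cvgr_lt _ (cv2 y)).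
by apply: filterS2 near1 near2 => x /ltW x1 /ltW x2; split.
Qed.

(** On the face [v1 = c], [A (v2 y) <= A (sigma c) < G c] makes [v1] decrease; on the face
    [v2 = sigma c], [B (v1 y) <= B c < sigma c] makes [v2] decrease. *)
Lemma gain_sublevel_stays z c t0 : solution_in z -> 0 < c -> c <= d ->
  0 <= t0 -> gain_sublevel c (z t0) ->
  forall t, t0 <= t -> gain_sublevel c (z t).
Proof.
move=> zS c0 cd t00 zt0; have c0' := ltW c0.
have Kcd := le_gain_sublevel c0' cd.
have [sB sA] := sigmaP c0.
apply: solution_stays zt0 _ => //; [exact: zS.1|exact: closed_gain_sublevel|].
move=> t t0t Kt; have [Kt1 Kt2] := Kt; have t_ge0 := le_trans t00 t0t.
have Ot := KO (Kcd _ Kt).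
have [|e1 e10 H1] := lie_sublevel_extend vl1 zS oO t_ge0 Ot Kt1.
  move=> v1c; apply: l1_lt0; [exact: Kcd|by rewrite v1c|rewrite v1c].
  by apply: le_lt_trans sA; exact: classK_le.
have [|e2 e20 H2] := lie_sublevel_extend vl2 zS oO t_ge0 Ot Kt2.
  move=> v2c; apply: l2_lt0; [exact: Kcd|rewrite v2c|rewrite v2c].
    by rewrite (le_lt_trans _ sB)// classK_ge0.
  by rewrite (le_lt_trans _ sB)// classK_le.
exists (Num.min e1 e2); first by rewrite lt_min e10.
move=> s ts; rewrite -ltrBlDl lt_min !ltrBlDl => /andP[s1 s2].
by split; [exact: H1|exact: H2].
Qed.

(** By continuity the strict gain inequalities at [c] survive when the two sides are evaluated at
    different nearby levels: one already entered, the other slightly lower. *)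
Lemma gain_interval c : 0 < c -> exists2 e, 0 < e & forall s t, 0 <= s ->
  0 <= t -> `|s - c| < e -> `|t - c| < e -> A (sigma t) < G s /\ B t < sigma s.
Proof.
move=> c0; have [sB sA] := sigmaP c0.
have near_c (a b : R -> R) : classK a -> classK b -> a c < b c ->
    exists2 e, 0 < e & forall s t, 0 <= s -> 0 <= t -> `|s - c| < e ->
      `|t - c| < e -> a t < b s.
  move=> aK bK ab; pose m := (a c + b c) / 2.
  have am : a c < m by rewrite /m; lra.
  have mb : m < b c by rewrite /m; lra.
  have cn : c = `|c| by rewrite gtr0_norm.
  have na : \forall t \near c, a `|t| < m.
    case: aK => /continuous_within_normE/(_ c) ca _ _.
    by apply: (cvgr_lt _ ca); rewrite -cn.
  have nb : \forall t \near c, m < b `|t|.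
    case: bK => /continuous_within_normE/(_ c) cb _ _.
    by apply: (cvgr_gt _ cb); rewrite -cn.
  have /nbhs_ballP[e /= e0 He] : nbhs c ([set t | a `|t| < m] `&`
      [set t | m < b `|t|]) by exact: filterI.
  exists e => // s t s0 t0 se te; rewrite distrC in se; rewrite distrC in te.
  have [/=] := He t te; rewrite ger0_norm// => /lt_trans + _; apply.
  by have [_ /=] := He s se; rewrite ger0_norm.
have [e1 e10 H1] := near_c _ _ (classK_comp sigmaK AK) GK sA.
have [e2 e20 H2] := near_c _ _ BK sigmaK sB.
exists (Num.min e1 e2); first by rewrite lt_min e10.
move=> s t s0 t0; rewrite !lt_min => /andP[s1 s2] /andP[t1 t2].
by split; [exact: H1|exact: H2].
Qed.

(* If the infimum [c] of the levels eventually entered were positive, then near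
   [c] the strict gains would drive both functions below a level under [c]. *)
Lemma gain_sublevel_attracts z c : solution_in z -> gain_sublevel d (z 0) ->
  0 < d -> 0 < c ->
  exists2 T, 0 <= T & forall t, T <= t -> gain_sublevel c (z t).
Proof.
move=> zS z0 d0 c0.
pose S := [set b | [/\ 0 < b, b <= d & exists2 T, 0 <= T &
  forall t, T <= t -> gain_sublevel b (z t)]].
have Sd : S d.
  by split => //; exists 0 => //; exact: gain_sublevel_stays.
have Sinf : has_inf S by split; [exists d|exists 0 => b [/ltW]].
pose m := inf S.
have m0 : 0 <= m by apply: lb_le_inf; [exists d|move=> b [/ltW]].
have md : m <= d by apply: ge_inf Sd; exact: Sinf.2.
have [mc|cm] := ltP m c.
  have [|b Sb] := @inf_adherent _ S (c - m) _ Sinf; first by rewrite subr_gt0.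
  rewrite -/m addrC subrK => bc; have [b0 _ [T T0 HT]] := Sb.
  exists T => // t Tt; apply: le_gain_sublevel (HT t Tt); exact: ltW.
have {}m0 : 0 < m by exact: lt_le_trans cm.
have [e e0 He] := gain_interval m0.
(* A positive level under the infimum [m] and within [e] of it; [b1] below is an entered level, at
   least [m] and also within [e]. *)
pose b0 := m - Num.min e m / 2.
have me : Num.min e m <= e by rewrite ge_min lexx.
have mm : Num.min e m <= m by rewrite ge_min lexx orbT.
have min0 : 0 < Num.min e m by rewrite lt_min e0.
have b0_gt0 : 0 < b0 by rewrite /b0; lra.
have b0m : b0 < m by rewrite /b0; lra.
have [b1 Sb1] := inf_adherent e0 Sinf; rewrite -/m => b1m.
have mb1 : m <= b1 by apply: ge_inf Sb1; exact: Sinf.2.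
have [b1_gt0 b1d [T T0 HT]] := Sb1.
have [||||AG Bs] := He b0 b1.
- exact: ltW.
- exact: ltW.
- by rewrite ltr0_norm /b0; lra.
- by rewrite ger0_norm; lra.
have K1d := le_gain_sublevel (ltW b1_gt0) b1d.
have cK1 : compact (gain_sublevel b1).
  exact: (subclosed_compact (@closed_gain_sublevel b1) cK K1d).
have K1O : gain_sublevel b1 `<=` O by move=> y /K1d /KO.
(* Inside level [b1], as long as [b0 <= v1 y], one has [A (v2 y) <= A (sigma b1) < G b0 <= G (v1
   y)], so [v1] is driven below [b0]. *)
have [|T1 T1_ge HT1] := @lie_eventually_le _ _ _ vl1 zS oO _ b0 T cK1 K1O _ T0 HT.
  move=> y K1y b0y; apply: l1_lt0; first exact: K1d.
    exact: lt_le_trans b0y.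
  apply: (@le_lt_trans _ _ (A (sigma b1))).
    by apply: classK_le => //; case: K1y.
  by apply: (lt_le_trans AG); apply: classK_le => //; exact: ltW.
have [|T2 T2_ge HT2] :=
    @lie_eventually_le _ _ _ vl2 zS oO _ (sigma b0) T cK1 K1O _ T0 HT.
  move=> y K1y b0y; apply: l2_lt0; first exact: K1d.
    by apply: lt_le_trans b0y; exact: classK_gt0.
  apply: (@le_lt_trans _ _ (B b1)); first by apply: classK_le => //; case: K1y.
  exact: lt_le_trans b0y.
have Sb0 : S b0.
  split => //; first by rewrite (le_trans (ltW b0m)).
  exists (Num.max T1 T2).
    by rewrite le_max (le_trans T0 T1_ge).
  by move=> t; rewrite ge_max => /andP[t1 t2]; split; [exact: HT1|exact: HT2].
by have := ge_inf Sinf.2 Sb0; rewrite leNgt b0m.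
Qed.

End small_gain.

End solutions_in_a_set.

(** * Local existence for a field continuous near a compact set *)

Section existence.
Context {R : realType} {E : normedModType R}.

Lemma lie_derivativeW (O O' : set E) (F : E -> E) (v l : E -> R) :
  O' `<=` O -> lie_derivative O F v l -> lie_derivative O' F v l.
Proof.
move=> O'O [cv cl dv]; split => // [y /O'O|z t /O'O]; [exact: cl|exact: dv].
Qed.

(* Where [F] is large it is replaced by [0], so that Euler polygons are
   Lipschitz; near [K] nothing changes. *)
Lemma exists_solution_in (O K : set E) (F : E -> E) (z0 : E) :
  (forall r, compact [set y : E | `|y| <= r]) ->
  open O -> K `<=` O -> compact K -> (forall y, O y -> {for y, continuous F}) ->
  exists O' z, [/\ open O', K `<=` O', O' `<=` O, z 0 = z0 &
    solution_in O' F z].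
Proof.
move=> cE oO KO cK cF.
have FK : {within K, continuous F}.
  by apply: continuous_in_subspaceT => y /[!inE] /KO; exact: cF.
have [M M0 HM] : exists2 M : R, 0 < M & forall y, K y -> `|F y| < M.
  have [M M0 HM] := ex_strict_bound_gt0 (compact_bounded (continuous_compact FK cK)).
  by exists M => // y Ky; apply: HM; exists y.
pose G y := if `|F y| < M then F y else 0.
have G_le y : `|G y| <= M.
  by rewrite /G; case: ifPn => [/ltW//|_]; rewrite normr0 ltW.
(* On this open set [F] and [G] agree near every point, so continuity of [F] transfers to [G]. *)
pose O' := (O `&` [set y | `|F y| < M])°.
have O'O : O' `<=` O by move=> y /interior_subset[].
have KO' : K `<=` O'.
  move=> y Ky; have Oy := KO _ Ky; apply: filterI; first exact: open_nbhs_nbhs.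
  apply: (cvgr_lt (`|F y|)); last exact: HM.
  exact: (cvg_norm (cF _ Oy)).
have GF y : O' y -> \forall x \near y, F x = G x.
  by apply: filterS => x [_ /= Fx]; rewrite /G Fx.
have [z [z0E z_lip z_der]] := euler_limit z0 G_le cE.
exists O', z; split => //; first exact: open_interior.
split.
  apply/subspace_continuousP => t /=; rewrite in_itv/= andbT => t0.
  apply/cvgrPdist_lt => e e0.
  rewrite near_withinE; apply/nbhs_ballP; exists (e / (M + 1)) => /=.
    by rewrite divr_gt0// addr_gt0.
  move=> s; rewrite /ball/= ltr_pdivlMr ?addr_gt0// => ts /[!in_itv]/= /[!andbT] s0.
  apply: le_lt_trans ts.
  have := normr_ge0 (t - s); rewrite mulrDr mulr1 (mulrC _ M) => n0.
  have [st|/ltW st] := leP s t.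
    have := z_lip s t s0 st; rewrite (ger0_norm (_ : 0 <= t - s)) ?subr_ge0//.
    by rewrite -subr_ge0 in st; lra.
  have := z_lip t s t0 st; rewrite distrC (distrC t s).
  rewrite (ger0_norm (_ : 0 <= s - t)) ?subr_ge0//.
  by rewrite -subr_ge0 in st; lra.
move=> t t0 O't; have GFt := nbhs_singleton (GF _ O't).
rewrite GFt; apply: z_der => //; rewrite /prop_for /continuous_at -GFt.
apply: cvg_trans (cF _ (O'O _ O't)); apply: near_eq_cvg; exact: GF.
Qed.

End existence.

(** * Norms, gradients and derivatives of column vectors *)

Section matrices.
Context {R : realType}.

(** Transposition preserves the sup norm, so Heine-Borel carries over from row vectors. *)
Lemma compact_norm_le_cV n (r : R) : compact [set y : 'cV[R]_n | `|y| <= r].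
Proof.
have norm_tr m k (y : 'M[R]_(m, k)) : `|y^T| <= `|y|.
  rewrite [leLHS]/Num.norm/= mx_normrE; apply/bigmax_leP; split=> //= -[i j] _.
  rewrite mxE [leRHS]/Num.norm/= mx_normrE.
  by apply/bigmax_geP; right; exists (j, i).
have ctr : continuous (fun y : 'rV[R]_n => y^T).
  move=> y; apply/(@cvgrPdist_lt _ _ _ (nbhs y) (nbhs_filter y)) => e e0.
  near=> x; rewrite -linearB; apply: (le_lt_trans (norm_tr _ _ _)).
  by near: x; exact: cvgr_dist_lt.
have : compact [set y : 'rV[R]_n | `|y| <= r].
  apply: bounded_closed_compact.
    by exists r; split=> [|M rM y /= yr]; [exact: num_real|rewrite (le_trans yr)// ltW].
  apply: (@closed_comp _ _ (fun y : 'rV[R]_n => `|y|) [set s : R | s <= r]).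
    by move=> y _; exact: norm_continuous.
  exact: closed_le.
move=> /(continuous_compact (continuous_subspaceT ctr)).
congr compact; apply/seteqP; split=> [_ [y yr <-]/=|y /= yr].
  exact: le_trans (norm_tr _ _ _) yr.
by exists y^T; rewrite /= ?trmxK// (le_trans (norm_tr _ _ _)).
Unshelve. all: by end_near. Qed.

Lemma norm_le_enorm n (y : 'cV[R]_n) : `|y| <= enorm y.
Proof.
rewrite [leLHS]/Num.norm/= mx_normrE; apply/bigmax_leP.
split=> [|[i j] _] /=; first exact: sqrtr_ge0.
rewrite ord1 -sqrtr_sqr ler_wsqrtr// (bigD1 i)//= lerDl sumr_ge0// => k _.
exact: sqr_ge0.
Qed.

Lemma enorm_ge0 n (y : 'cV[R]_n) : 0 <= enorm y.
Proof. exact: sqrtr_ge0. Qed.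

Lemma enorm_eq0 n (y : 'cV[R]_n) : enorm y = 0 -> y = 0.
Proof.
move=> y0; apply/eqP; rewrite -normr_eq0 eq_le normr_ge0 andbT -y0.
exact: norm_le_enorm.
Qed.

Lemma compact_norm_le_prod n p (r : R) :
  compact [set y : 'cV[R]_p * 'cV[R]_n | `|y| <= r].
Proof.
have := compact_setX (@compact_norm_le_cV p r) (@compact_norm_le_cV n r).
congr compact; apply/seteqP; split=> -[a b] /=.
  by move=> [ar br]; rewrite [leLHS]/Num.norm/= ge_max ar.
by rewrite [X in X <= _ -> _]/Num.norm/= ge_max => /andP.
Qed.

Lemma continuous_sum (T : topologicalType) n (f : 'I_n -> T -> R) (y : T) :
  (forall j, {for y, continuous (f j)}) ->
  {for y, continuous (fun x => \sum_j f j x)}.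
Proof.
move=> cf; apply: (cvg_big (op := +%R)) => [|j _]; last exact: cf.
exact: add_continuous.
Qed.

Lemma continuous_mul (T : topologicalType) (f g : T -> R) (y : T) :
  {for y, continuous f} -> {for y, continuous g} ->
  {for y, continuous (fun x => f x * g x)}.
Proof. by move=> cf cg; exact: cvgM. Qed.

Lemma continuous_pair (T T1 T2 : topologicalType) (h1 : T -> T1) (h2 : T -> T2)
    (y : T) : {for y, continuous h1} -> {for y, continuous h2} ->
  {for y, continuous (fun x => (h1 x, h2 x))}.
Proof. by move=> ch1 ch2; exact: cvg_pair ch1 ch2. Qed.

Lemma continuous_enorm_sqr n : continuous (fun y : 'cV[R]_n => enorm y ^+ 2).
Proof.
move=> y; have -> : (fun y : 'cV[R]_n => enorm y ^+ 2) =
    (fun y => \sum_i y i 0 * y i 0).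
  apply/funext => x; rewrite sqr_sqrtr ?sumr_ge0//.
  by move=> i _; exact: sqr_ge0.
by apply: continuous_sum => j; apply: continuous_mul; exact: coord_continuous.
Qed.

Lemma gradM n (h : 'cV[R]_n -> R) (x v : 'cV[R]_n) :
  (grad h x *m v) 0 0 = \sum_j 'D_(delta_mx j 0) h x * v j 0.
Proof. by rewrite mxE; apply: eq_bigr => j _; rewrite mxE. Qed.

Lemma gradMD n (h : 'cV[R]_n -> R) (x a b : 'cV[R]_n) (k : R) :
  (grad h x *m (a + k *: b)) 0 0 =
  (grad h x *m a) 0 0 + k * (grad h x *m b) 0 0.
Proof. by rewrite mulmxDr -scalemxAr mxE [X in _ + X]mxE. Qed.

Lemma continuous_gradM (T : topologicalType) n (h : 'cV[R]_n -> R)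
    (a b : T -> 'cV[R]_n) (y : T) : C1 h ->
  {for y, continuous a} -> {for y, continuous b} ->
  {for y, continuous (fun t => (grad h (a t) *m b t) 0 0)}.
Proof.
move=> [_ ch] ca cb; rewrite (_ : (fun t => _) = fun t =>
  \sum_j 'D_(delta_mx j 0) h (a t) * b t j 0); last first.
  by apply/funext => t; rewrite gradM.
apply: continuous_sum => j; apply: continuous_mul.
  exact: (@continuous_comp _ _ _ a _ y ca (ch (delta_mx j 0) (a y) I)).
exact: (@continuous_comp _ _ _ b _ y cb (@coord_continuous _ _ _ j 0 (b y))).
Qed.

Lemma C1_continuous n (h : 'cV[R]_n -> R) : C1 h -> continuous h.
Proof. by move=> [dh _] y; apply: differentiable_continuous; exact: dh. Qed.

Lemma is_derive_grad n (h : 'cV[R]_n -> R) (y : R -> 'cV[R]_n) t dy :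
  differentiable h (y t) -> is_derive t 1 y dy ->
  is_derive t 1 (h \o y) ((grad h (y t) *m dy) 0 0).
Proof.
move=> dh [/derivable1_diffP dify dyE].
have dify' := differentiable_comp dify dh.
apply: DeriveDef; first exact/derivable1_diffP.
rewrite (deriveE _ dify') diff_comp//= -(deriveE _ dify) dyE gradM.
rewrite {1}(matrix_sum_delta dy) linear_sum; apply: eq_bigr => i _.
rewrite big_ord1 linearZ/= deriveE//.
by rewrite mulrC.
Qed.

End matrices.

Section projections.
Context {R : realType} {U V : normedModType R}.

Lemma is_derive_fst (z : R -> U * V) (t : R) (dz : U * V) :
  is_derive t 1 z dz -> is_derive t 1 (fst \o z) dz.1.
Proof.
move=> [dz' dzE].
have H : h^-1 *: ((fst \o z) (h *: 1 + t) - (fst \o z) t) @[h --> 0^'] --> dz.1.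
  have H0 : h^-1 *: (z (h *: 1 + t) - z t) @[h --> 0^'] --> dz.
    by rewrite -dzE.
  exact: (@cvg_comp _ _ _ _ fst _ (nbhs dz) _ H0 cvg_fst).
by apply: DeriveDef; [apply/cvg_ex; exists dz.1|exact: cvg_lim H].
Qed.

Lemma is_derive_snd (z : R -> U * V) (t : R) (dz : U * V) :
  is_derive t 1 z dz -> is_derive t 1 (snd \o z) dz.2.
Proof.
move=> [dz' dzE].
have H : h^-1 *: ((snd \o z) (h *: 1 + t) - (snd \o z) t) @[h --> 0^'] --> dz.2.
  have H0 : h^-1 *: (z (h *: 1 + t) - z t) @[h --> 0^'] --> dz.
    by rewrite -dzE.
  exact: (@cvg_comp _ _ _ _ snd _ (nbhs dz) _ H0 cvg_snd).
by apply: DeriveDef; [apply/cvg_ex; exists dz.2|exact: cvg_lim H].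
Qed.

End projections.

Lemma locally_lipschitz_continuous (R : realType) (U V : normedModType R)
  (f : U -> V) : locally_lipschitz f -> continuous f.
Proof.
move=> fl x; have [k k0 Hk] := pinfty_ex_gt0 (fl x).
apply/cvgrPdist_lt => e e0; near=> y.
have xy : `|f x - f y| <= k * `|x - y|.
  near: y; move: Hk => [[A B] /= [Ax Bx] AB].
  by apply: filterS Bx => y By; apply: (AB (x, y)); split => //; exact: nbhs_singleton.
apply: (le_lt_trans xy); rewrite -ltr_pdivlMl// mulrC; near: y.
by apply: cvgr_dist_lt; rewrite ?divr_gt0.
Unshelve. all: by end_near. Qed.

(** * The redesigned closed loop *)

Lemma smooth_on_continuous (R : realType) (E : normedModType R) (A : set E)
    (h : E -> R) : smooth_on A h ->
  exists U, [/\ open U, A `<=` U & forall y, U y -> {for y, continuous h}].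
Proof. by move=> [U [oU AU /(_ 0%N) ch]]; exists U. Qed.

(** Monotonicity of [rho] bounds the gain below by a linear function of slope [eps * rho 0 / 2],
    hence unboundedness; the factor [s] makes the growth strict. *)
Lemma classKinf_redesign_gain (R : realType) (eps : R) (rho : R -> R) :
  0 < eps -> smooth_on (E := R^o) `[0, +oo[ rho ->
  (forall s t, 0 <= s -> s <= t -> rho s <= rho t) ->
  (forall s, 0 <= s -> 0 < rho s) -> classKinf (redesign_gain eps rho).
Proof.
move=> eps0 /smooth_on_continuous[U [_ AU cU]] rho_le rho0.
have ge (s : R) : 0 <= s -> 1 / 2 * eps * rho 0 * s <= redesign_gain eps rho s.
  move=> s0; rewrite /redesign_gain ler_wpM2r// ler_pM2l ?mulr_gt0//.
  by rewrite rho_le ?sqr_ge0.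
have c0 : 0 < 1 / 2 * eps * rho 0 by rewrite !mulr_gt0// rho0.
apply: (@classKinf_ge _ _ (fun s => 1 / 2 * eps * rho 0 * s)) => //; last first.
  split; first exact: (classKZ c0 classKinf_id.1).
  move=> M; exists ((`|M| + 1) / (1 / 2 * eps * rho 0)).
    by rewrite divr_ge0 ?addr_ge0// ltW.
  by rewrite mulrC divfK ?gt_eqF// (le_lt_trans (ler_norm M))// ltrDl.
split.
- apply/continuous_within_normE => s; rewrite /redesign_gain.
  have cs : {for s, continuous (fun t : R => `|t| ^+ 2)}.
    by apply: (@continuous_mul _ _ Num.norm Num.norm s); exact: norm_continuous.
  have cr : {for s, continuous (fun t : R => rho (`|t| ^+ 2))}.
    apply: (@continuous_comp _ _ _ (fun t : R => `|t| ^+ 2) rho s cs).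
    by apply: cU; apply: AU; rewrite /= in_itv/= sqr_ge0.
  have ck : {for s, continuous (fun t : R => 1 / 2 * eps * rho (`|t| ^+ 2))}.
    by apply: continuous_mul cr; exact: cst_continuous.
  exact: continuous_mul ck (@norm_continuous _ R s).
- by rewrite /redesign_gain mulr0.
- move=> s t s0 st; rewrite /redesign_gain.
  have t0 : 0 < t by exact: le_lt_trans st.
  have rst : rho (s ^+ 2) <= rho (t ^+ 2).
    by rewrite rho_le ?sqr_ge0// ler_sqr ?nnegrE// ltW.
  apply: (@le_lt_trans _ _ (1 / 2 * eps * rho (t ^+ 2) * s)).
    by rewrite ler_wpM2r// ler_pM2l// mulr_gt0.
  by rewrite ltr_pM2l// !mulr_gt0// rho0// sqr_ge0.
Qed.

(* Completing the square in [r P u'] leaves [((D + e) / P) ^+ 2], and the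
   small-gain bounds on [D] and [e] make it at most [eps ^+ 2 * s ^+ 2]. *)
Lemma redesign_dissipation (R : realType) (r eps P s q a b ui u' uh D e : R) :
  0 < r -> 0 < P -> 0 = a + ui * b + q + r * ui ^+ 2 ->
  u' = - (1 / (2 * r)) * b ->
  e = r / 2 * P ^+ 2 * (uh - u') + uh - ui ->
  `|D| <= 1 / 2 * eps * P * s -> `|e| <= 1 / 2 * eps * P * s ->
  a + ((1 + r / 2 * P ^+ 2) * uh + D) * b <= - (q - eps ^+ 2 * s ^+ 2).
Proof.
move=> r0 P0 aE u'E eE Dle ele.
have bE : b = - (2 * r) * u' by rewrite u'E; field; rewrite gt_eqF.
pose k := (D + e) / P.
have DE : D = k * P - e by rewrite /k divfK ?gt_eqF// addrK.
(* The factor [1 / 2] in the gain lets the bounds on [D] and [e] add up to [eps * P * s]. *)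
have kle : `|k| <= eps * s.
  rewrite /k normrM normfV (gtr0_norm P0) ler_pdivrMr//.
  by rewrite (le_trans (ler_normD _ _))//; lra.
have k2 : k ^+ 2 <= eps ^+ 2 * s ^+ 2.
  rewrite -exprMn -real_normK ?num_real// ler_sqr ?nnegrE//.
  exact: le_trans kle.
have -> : a = - ui * b - q - r * ui ^+ 2 by lra.
(* The form of [e] cancels [uh]: the total input is [ui + r / 2 * P ^+ 2 * u' + k * P], and
   [b = - (2 * r) * u'] then completes the square. *)
have -> : - ui * b - q - r * ui ^+ 2 + ((1 + r / 2 * P ^+ 2) * uh + D) * b =
    - q - r * ui ^+ 2 - (r * P * u' + k) ^+ 2 + k ^+ 2.
  by rewrite DE eE bE; field.
have := sqr_ge0 (r * P * u' + k).
have : 0 <= r * ui ^+ 2 by rewrite mulr_ge0 ?sqr_ge0// ltW.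
lra.
Qed.

(** Only finitely many basis functions occur, so near each point of [Om] they are all continuous on
    a common neighbourhood. *)
Lemma lincomb_continuous (R : realType) n (phi : nat -> 'cV[R]_n -> R) N
    (c : 'rV[R]_N) (Om : set 'cV[R]_n) :
  (forall j, smooth_on Om (phi j)) ->
  exists U, [/\ open U, Om `<=` U &
    forall y, U y -> {for y, continuous (lincomb phi c)}].
Proof.
move=> sphi; exists [set y | {for y, continuous (lincomb phi c)}]°; split.
- exact: open_interior.
- move=> y Omy.
  have : \forall x \near y, forall j : 'I_N, {for x, continuous (phi j)}.
    apply: (@filter_forall _ _
      (fun (j : 'I_N) x => {for x, continuous (phi j)}) (nbhs y)) => j.
    have [U [oU OmU cU]] := smooth_on_continuous (sphi j).
    by apply: filterS cU _; apply: open_nbhs_nbhs; split=> //; exact: OmU.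
  apply: filterS => x cx; apply: continuous_sum => j.
  by apply: continuous_mul; [exact: cst_continuous|exact: cx].
- by move=> y /interior_subset.
Qed.

Lemma continuous_robust_policy (R : realType) n (r : R) (rho : R -> R)
    (uh : 'cV[R]_n -> R) (y : 'cV[R]_n) :
  (forall s, 0 <= s -> {for s, continuous rho}) ->
  {for y, continuous uh} -> {for y, continuous (robust_policy r rho uh)}.
Proof.
move=> crho cuh.
have cr : {for y, continuous (fun x : 'cV[R]_n => rho (enorm x ^+ 2))}.
  apply: (@continuous_comp _ _ _ (fun x : 'cV[R]_n => enorm x ^+ 2) rho y).
    exact: continuous_enorm_sqr.
  by apply: crho; exact: sqr_ge0.
have cr2 : {for y, continuous (fun x : 'cV[R]_n => rho (enorm x ^+ 2) ^+ 2)}.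
  exact: (continuous_mul cr cr).
have ck : {for y, continuous (fun x : 'cV[R]_n =>
    r / 2 * rho (enorm x ^+ 2) ^+ 2)}.
  by apply: (continuous_mul _ cr2); exact: cst_continuous.
have ck1 : {for y, continuous (fun x : 'cV[R]_n =>
    1 + r / 2 * rho (enorm x ^+ 2) ^+ 2)}.
  by apply: (continuousD _ ck); exact: cst_continuous.
exact: (continuous_mul ck1 cuh).
Qed.

Theorem theorem3p2 (R : realType) (n p : nat)
  (* the system *)
  (f g : 'cV[R]_n -> 'cV[R]_n)
  (Dw : 'cV[R]_p * 'cV[R]_n -> 'cV[R]_p) (D : 'cV[R]_p * 'cV[R]_n -> R)
  (f_lip : locally_lipschitz f) (g_lip : locally_lipschitz g)
  (Dw_lip : locally_lipschitz Dw)
  (D_lip : locally_lipschitz (D : 'cV[R]_p * 'cV[R]_n -> R^o))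
  (* cost and initial admissible policy *)
  (Q : 'cV[R]_n -> R) (r : R) (Q_pd : posdef Q) (r_gt0 : 0 < r)
  (u0 : 'cV[R]_n -> R) (u0_adm : admissible f g Q r u0)
  (* exact policy iteration; the policies are u_i = policy g r u0 V i *)
  (V : nat -> 'cV[R]_n -> R)
  (V_eval : forall i, policy_evaluation f g Q r (policy g r u0 V i) (V i))
  (* optimal value function; the optimal policy is improved g r Vs *)
  (Vs : 'cV[R]_n -> R) (Vs_HJB : HJB f g Q r Vs)
  (* basis functions *)
  (Om : set 'cV[R]_n) (Om_compact : compact Om) (Om_0 : Om° 0)
  (phi : nat -> 'cV[R]_n -> R)
  (phi_smooth : forall j, smooth_on Om (phi j))
  (phi_0 : forall j, phi j 0 = 0)
  (phi_indep : lin_indep_on Om phi)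
  (* data and learned weights *)
  (N1 N2 l : nat) (tm : nat -> R) (tm_incr : forall k, tm k < tm k.+1)
  (u : R -> R) (w : R -> 'cV[R]_p) (x : R -> 'cV[R]_n)
  (wx_traj : driven_trajectory Dw D f g (tm 0%N) (tm l.+1) u w x)
  (chat : nat -> 'rV[R]_N1) (what : nat -> 'rV[R]_N2)
  (weights_opt : forall i,
    least_squares Q r D phi tm l u w x
      (learned_policy u0 phi what i) (chat i) (what i))
  (* the stopping index *)
  (istar : nat) (istar_gt0 : (0 < istar)%N)
  (eps' : R) (eps'_gt0 : 0 < eps')
  (approx : forall i, (istar < i)%N -> forall y, Om y ->
    `|lincomb phi (chat i) y - Vs y| <= eps' /\
    `|learned_policy u0 phi what i.+1 y - improved g r Vs y| <= eps')
  (* redesign function *)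
  (rho : R -> R) (rho_smooth : smooth_on (E := R^o) `[0, +oo[ rho)
  (rho_ndecr : forall s t, 0 <= s -> s <= t -> rho s <= rho t)
  (rho_gt0 : forall s, 0 <= s -> 0 < rho s)
  (* assumption (A) *)
  (alphaL alphaU : R -> R)
  (alphaL_Kinf : classKinf alphaL) (alphaU_Kinf : classKinf alphaU)
  (V_lb : forall i y, alphaL (enorm y) <= V i y)
  (V_ub : forall i y, V i y <= alphaU (enorm y))
  (eps : R) (eps_gt0 : 0 < eps)
  (Q_eps : posdef (fun y => Q y - eps ^+ 2 * enorm y ^+ 2))
  (* assumption (B) *)
  (lamL lamU kappa1 kappa2 kappa3 : R -> R) (W kappa4 : 'cV[R]_p -> R)
  (lamL_Kinf : classKinf lamL) (lamU_Kinf : classKinf lamU)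
  (kappa1_K : classK kappa1) (kappa2_K : classK kappa2)
  (kappa3_K : classK kappa3)
  (W_C1 : C1 W) (W_pd : posdef W) (kappa4_pd : posdef kappa4)
  (W_bounds : forall a, lamL (enorm a) <= W a <= lamU (enorm a))
  (D_bound : forall a y,
    `|D (a, y)| <= Num.max (kappa1 (enorm a)) (kappa2 (enorm y)))
  (W_decr : forall a y, kappa3 (enorm y) <= W a ->
    (grad W a *m Dw (a, y)) 0 0 <= - kappa4 a)
  (* small-gain condition *)
  (small_gain : forall s, 0 < s ->
    Num.max (kappa2 s)
      (kappa1 (Kinv lamL (kappa3 (Kinv alphaL (alphaU s)))))
    < redesign_gain eps rho s)
  (d : R) (d_gt0 : 0 < d)
  (Om_sublevel : [set y | V istar y <= d] `<=` Om)
  (ero_small : forall y, 0 < V istar y <= d ->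
    `|redesign_error r rho (learned_policy u0 phi what istar.+1)
        (policy g r u0 V istar.+1) (policy g r u0 V istar) y|
    < redesign_gain eps rho (enorm y)) :
  let F := closed_loop Dw D f g
    (robust_policy r rho (learned_policy u0 phi what istar.+1)) in
  asymptotically_stable F /\
  exists sigma : R -> R, classKinf sigma /\
    [set z : 'cV[R]_p * 'cV[R]_n |
      Num.max (sigma (V istar z.2)) (W z.1) <= sigma d]
    `<=` region_of_attraction F.
Proof.
set uh := learned_policy u0 phi what istar.+1.
set ui := policy g r u0 V istar.
set u' := policy g r u0 V istar.+1.
move=> F.
have [V_C1 V0 V_HJ] := V_eval istar.
have [U [oU OmU cuh]] := lincomb_continuous (what istar) phi_smooth.
have gainK := classKinf_redesign_gain eps_gt0 rho_smooth rho_ndecr rho_gt0.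
have [Ur [_ rhoU crho]] := smooth_on_continuous rho_smooth.
have [W0 _] := W_pd.
have V_ge0 y : 0 <= V istar y.
  exact: le_trans (classK_ge0 alphaL_Kinf.1 (enorm_ge0 _)) (V_lb _ _).
have W_ge0 a : 0 <= W a.
  have /andP[+ _] := W_bounds a; apply: le_trans.
  exact: classK_ge0 lamL_Kinf.1 (enorm_ge0 _).
(* In terms of the values of V and W: [A] bounds the effect of w on [D], W
   decreases above [B], and V decreases as long as [A] stays below [G]. *)
pose A := kappa1 \o Kinv lamL; pose B := kappa3 \o Kinv alphaL.
pose G := redesign_gain eps rho \o Kinv alphaU.
have AK : classK A := classK_comp (classKinf_Kinv lamL_Kinf).1 kappa1_K.
have BK : classK B := classK_comp (classKinf_Kinv alphaL_Kinf).1 kappa3_K.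
have GK : classKinf G := classKinf_comp (classKinf_Kinv alphaU_Kinf) gainK.
have [|sigma sigmaK sigmaP] := small_gain_interpolation AK BK GK.
  (* The small-gain hypothesis is used at [Kinv alphaU s], where [alphaU] cancels. *)
  move=> s s0; have k0 := classK_gt0 (classKinf_Kinv alphaU_Kinf).1 s0.
  by have := small_gain _ k0; rewrite gt_max KinvK ?(ltW s0)// => /andP[].
pose v1 (z : 'cV[R]_p * 'cV[R]_n) := V istar z.2.
pose v2 (z : 'cV[R]_p * 'cV[R]_n) := W z.1.
pose l1 z := (grad (V istar) z.2 *m (F z).2) 0 0.
pose l2 z := (grad W z.1 *m (F z).1) 0 0.
(* The learned policy is known to be continuous only on the neighbourhood [U] of [Om], so the
   analysis is confined to states over [U]. *)
pose O := [set z : 'cV[R]_p * 'cV[R]_n | U z.2].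
have c1 : continuous (fst : 'cV[R]_p * 'cV[R]_n -> 'cV[R]_p).
  by move=> z; exact: cvg_fst.
have c2 : continuous (snd : 'cV[R]_p * 'cV[R]_n -> 'cV[R]_n).
  by move=> z; exact: cvg_snd.
have oO : open O by apply: open_comp oU => z _; exact: c2.
have cF2 z : O z -> {for z, continuous (fun z => (F z).2)}.
  move=> Oz; apply: cvgD.
    apply: (@continuous_comp _ _ _ snd f z (c2 z)).
    exact: (locally_lipschitz_continuous f_lip).
  apply: cvgZ; last first.
    apply: (@continuous_comp _ _ _ snd g z (c2 z)).
    exact: (locally_lipschitz_continuous g_lip).
  apply: cvgD; last exact: (locally_lipschitz_continuous D_lip).
  apply: (@continuous_comp _ _ _ snd (robust_policy r rho uh) z (c2 z)).
  apply: continuous_robust_policy; last exact: cuh.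
  by move=> s s0; apply: crho; apply: rhoU; rewrite /= in_itv/= s0.
have cF1 z : {for z, continuous (fun z => (F z).1)}.
  exact: (locally_lipschitz_continuous Dw_lip).
have cF z : O z -> {for z, continuous F}.
  move=> Oz; have -> : F = fun z => ((F z).1, (F z).2).
    by apply/funext => t; case: (F t).
  by apply: continuous_pair; [exact: cF1|exact: cF2].
have vl1 : lie_derivative O F v1 l1.
  split.
  - by move=> z; apply: continuous_comp; [exact: c2|exact: C1_continuous].
  - move=> z Oz; exact: (@continuous_gradM R _ n (V istar) snd
      (fun z => (F z).2) z V_C1 (c2 z) (cF2 z Oz)).
  - move=> z t _ /is_derive_snd dz; apply: (is_derive_grad _ dz).
    by have [+ _] := V_C1; apply.
have vl2 : lie_derivative O F v2 l2.
  split.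
  - by move=> z; apply: continuous_comp; [exact: c1|exact: C1_continuous].
  - move=> z Oz; exact: (@continuous_gradM R _ p W fst (fun z => (F z).1) z
      W_C1 (c1 z) (cF1 z)).
  - move=> z t _ /is_derive_fst dz; apply: (is_derive_grad _ dz).
    by have [+ _] := W_C1; apply.
pose K := gain_sublevel v1 v2 sigma.
have KO : K d `<=` O by move=> z [/= Vd _]; apply: OmU; exact: Om_sublevel.
(* The sublevel set of [V istar] is closed in the compact [Om]; that of [W] is bounded through
   [lamL]. *)
have cK : compact (K d).
  have cV : compact [set y | V istar y <= d].
    apply: (subclosed_compact _ Om_compact Om_sublevel).
    apply: (@closed_comp _ _ (V istar) [set s | s <= d]) (@closed_le _ d).
    by move=> y _; exact: C1_continuous.
  have cW : compact [set a | W a <= sigma d].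
    apply: subclosed_compact (@compact_norm_le_cV R p (Kinv lamL (sigma d))) _.
      apply: (@closed_comp _ _ W [set s | s <= sigma d]) (@closed_le _ _).
      by move=> y _; exact: C1_continuous.
    move=> a /= Wa; apply: (le_trans (norm_le_enorm a)).
    rewrite -[leLHS](Kinv_can lamL_Kinf (enorm_ge0 a)).
    apply: classK_le (classKinf_Kinv lamL_Kinf).1 _ _.
      exact: classK_ge0 lamL_Kinf.1 (enorm_ge0 a).
    by have /andP[+ _] := W_bounds a => /le_trans; apply.
  have := compact_setX cW cV; congr compact; apply/seteqP.
  by split=> -[a y] /= [].
have l1_lt0 z : K d z -> 0 < v1 z -> A (v2 z) < G (v1 z) -> l1 z < 0.
  case: z => a y [/= Vyd Way] Vy0 AG; rewrite /v1/= in Vy0 Vyd AG.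
  have y0 : y != 0 by apply: contraTneq Vy0 => ->; rewrite V0 ltxx.
  have ey0 := enorm_ge0 y.
  (* The part of the bound due to [w] is controlled by the gain inequality [AG] and the upper bound
     [alphaU], the part due to [x] by the small-gain hypothesis on [kappa2]. *)
  have Dle : `|D (a, y)| <= redesign_gain eps rho (enorm y).
    apply: (le_trans (D_bound _ _)); rewrite ge_max; apply/andP; split.
      apply: (@le_trans _ _ (A (W a))).
        apply: classK_le kappa1_K (enorm_ge0 _) _.
        rewrite -[leLHS](Kinv_can lamL_Kinf (enorm_ge0 _)).
        apply: classK_le (classKinf_Kinv lamL_Kinf).1 _ _.
          exact: classK_ge0 lamL_Kinf.1 (enorm_ge0 _).
        by have /andP[] := W_bounds a.
      apply: (le_trans (ltW AG)); apply: classK_le gainK.1 _ _.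
        exact: Kinv_ge0.
      rewrite -[leRHS](Kinv_can alphaU_Kinf ey0).
      exact: classK_le (classKinf_Kinv alphaU_Kinf).1 _ (V_ub _ _).
    have /small_gain : 0 < enorm y.
      by rewrite lt_neqAle ey0 andbT eq_sym; apply: contra_neq y0 => /enorm_eq0.
    by rewrite gt_max => /andP[/ltW].
  have ele := ltW (ero_small y (introT andP (conj Vy0 Vyd))).
  pose vf := (grad (V istar) y *m f y) 0 0.
  pose vg := (grad (V istar) y *m g y) 0 0.
  have -> : l1 (a, y) = vf + (robust_policy r rho uh y + D (a, y)) * vg.
    exact: gradMD.
  have HJ : 0 = vf + ui y * vg + Q y + r * ui y ^+ 2.
    by have := V_HJ y; rewrite /nominal gradMD.
  have u'E : u' y = - (1 / (2 * r)) * vg.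
    by rewrite /u' /= /improved -trmx_mul mxE.
  have rho_y : 0 < rho (enorm y ^+ 2) by rewrite rho_gt0// sqr_ge0.
  apply: (le_lt_trans (redesign_dissipation r_gt0 rho_y HJ u'E erefl Dle ele)).
  by rewrite oppr_lt0; have [_] := Q_eps; apply.
have l2_lt0 z : K d z -> 0 < v2 z -> B (v1 z) < v2 z -> l2 z < 0.
  move=> Kz Wz Bz; have z1 : z.1 != 0.
    by apply: contraTneq Wz => z10; rewrite /v2 z10 W0 ltxx.
  have : kappa3 (enorm z.2) <= W z.1.
    apply: le_trans (ltW Bz); apply: classK_le kappa3_K (enorm_ge0 _) _.
    rewrite -[leLHS](Kinv_can alphaL_Kinf (enorm_ge0 _)).
    apply: classK_le (classKinf_Kinv alphaL_Kinf).1 _ (V_lb _ _).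
    exact: classK_ge0 alphaL_Kinf.1 (enorm_ge0 _).
  move=> /W_decr /le_lt_trans; rewrite /l2; case: (z) z1 => a y /= a0; apply.
  by have [_ ?] := kappa4_pd; rewrite oppr_lt0; auto.
have K_small e : 0 < e ->
    exists c, [/\ 0 < c, c <= d & K c `<=` [set z | `|z| < e]].
  have half_lt (s : R) : 0 < s -> s / 2 < s.
    by move=> s0; rewrite gtr_pMr// invf_lt1// ltr1n.
  move=> e0; have h0 : 0 < e / 2 by rewrite divr_gt0.
  have a0 := classK_gt0 alphaL_Kinf.1 h0; have b0 := classK_gt0 lamL_Kinf.1 h0.
  have sb0 := classK_gt0 (classKinf_Kinv sigmaK).1 b0.
  (* [V istar y <= c] forces [enorm y < e / 2] through [alphaL], and [W a <= sigma c] forces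
     [enorm a < e / 2] through [lamL]; the final halving makes both comparisons strict. *)
  pose c := Num.min d (Num.min (alphaL (e / 2)) (Kinv sigma (lamL (e / 2))) / 2).
  have c0 : 0 < c by rewrite /c lt_min d_gt0 divr_gt0// lt_min a0.
  have c_lt : c < Num.min (alphaL (e / 2)) (Kinv sigma (lamL (e / 2))).
    have m0 : 0 < Num.min (alphaL (e / 2)) (Kinv sigma (lamL (e / 2))).
      by rewrite lt_min a0.
    by rewrite /c gt_min half_lt// orbT.
  move: c_lt; rewrite lt_min => /andP[ca cb].
  exists c; split => //; first by rewrite /c ge_min lexx.
  move=> [a y] [/= Vc Wc].
  have ya : enorm y < e / 2.
    rewrite ltNge; apply/negP => /(classK_le alphaL_Kinf.1 (ltW h0)).
    by move=> /le_trans/(_ (V_lb istar y))/le_trans/(_ Vc); rewrite leNgt ca.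
  have aa : enorm a < e / 2.
    rewrite ltNge; apply/negP => /(classK_le lamL_Kinf.1 (ltW h0)) aa.
    have /andP[Wa _] := W_bounds a.
    have : lamL (e / 2) <= sigma c by exact: le_trans (le_trans aa Wa) Wc.
    rewrite leNgt -[ltRHS](KinvK sigmaK (ltW b0)).
    by have [_ _ ->] := sigmaK.1 => //; exact: ltW.
  rewrite [ltLHS]/Num.norm/= gt_max; apply/andP; split.
    exact: (le_lt_trans (norm_le_enorm a) (lt_trans aa (half_lt _ e0))).
  exact: (le_lt_trans (norm_le_enorm y) (lt_trans ya (half_lt _ e0))).
have K_nbhs c : 0 < c -> nbhs (0 : 'cV[R]_p * 'cV[R]_n) (K c).
  move=> c0; apply: (nbhs_gain_sublevel vl1 vl2).
    by rewrite /v1/= V0.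
  by rewrite /v2/= W0; exact: classK_gt0 sigmaK.1 c0.
have stays z c t0 := @gain_sublevel_stays _ _ O F v1 l1 v2 l2 A B G sigma d oO
  vl1 vl2 (fun z => V_ge0 z.2) (fun z => W_ge0 z.1) AK BK sigmaK.1 sigmaP KO
  l1_lt0 l2_lt0 z c t0.
have attracts z c := @gain_sublevel_attracts _ _ O F v1 l1 v2 l2 A B G sigma d
  oO vl1 vl2 (fun z => V_ge0 z.2) (fun z => W_ge0 z.1) AK BK GK.1 sigmaK.1
  sigmaP KO cK l1_lt0 l2_lt0 z c.
have sol_in z0 z : solution F z0 z -> solution_in O F z.
  by move=> [_ cz dz]; split=> // t t0 _; exact: dz.
have exists_sol z0 : K d z0 -> exists z, solution F z0 z.
  move=> Kz0.
  have [P [z [P_open KP PO z0E zS]]] := exists_solution_in z0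
    (@compact_norm_le_prod R n p) oO KO cK cF.
  (* The curve solves the equation only while in [P]. Invariance, applied with [P] in place of [O],
     keeps it in [K d], hence in [P], so the equation holds at all positive times. *)
  have zK t : 0 <= t -> K d (z t).
    apply: (@gain_sublevel_stays _ _ P F v1 l1 v2 l2 A B G sigma d P_open
      (lie_derivativeW PO vl1) (lie_derivativeW PO vl2)
      (fun z => V_ge0 z.2) (fun z => W_ge0 z.1) AK BK sigmaK.1 sigmaP KP
      l1_lt0 l2_lt0 z d 0) => //.
    by rewrite z0E.
  exists z; split => //; first exact: zS.1.
  by move=> t t0; apply: zS.2 => //; apply: KP; apply: zK; exact: ltW.
have roa : K d `<=` region_of_attraction F.
  move=> z0 Kz0; split; first exact: exists_sol.
  move=> z zS; apply/cvgrPdist_lt => e e0.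
  have [c [c0 cd Kc]] := K_small _ e0.
  have [|T T0 HT] := attracts z c (sol_in _ _ zS) _ d_gt0 c0.
    by case: zS => ->.
  exists T; split; first exact: num_real.
  by move=> t Tt; rewrite sub0r normrN; apply: Kc; apply: HT; exact: ltW.
split; last first.
  have [_ _ sigma_incr] := sigmaK.1.
  (* Strict monotonicity of [sigma] turns [sigma (V istar z.2) <= sigma d] into [V istar z.2 <= d],
     so the claimed set lies in [K d]. *)
  exists sigma; split => // z /=; rewrite ge_max => /andP[Vz Wz]; apply: roa.
  split => //; rewrite leNgt; apply/negP => /(sigma_incr _ _ (ltW d_gt0)).
  by rewrite ltNge Vz.
split; last by apply: filterS roa _; exact: K_nbhs.
move=> e e0; have [c [c0 cd Kc]] := K_small _ e0.
have /nbhs_normP[delta /= delta0 Hdelta] := K_nbhs _ c0.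
exists delta => // z0 z0d.
have Kz0 : K c z0 by apply: Hdelta; rewrite /= sub0r normrN.
split.
  apply: exists_sol.
  exact: (@le_gain_sublevel _ _ v1 v2 sigma sigmaK.1 c d (ltW c0) cd).
move=> z zS t t0; apply: Kc; apply: (stays z c 0) => //; first exact: sol_in zS.
by case: zS => ->.
Qed.
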